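(* Suppose one of the following two conditions holds. Case 1: for each $1\le k\le n$ the cost $f_k:\mathbb{R}^d\to\mathbb{R}$ is $\mu_k$-strongly convex ($\mu_k>0$) and $L_k$-smooth; put $\alpha_0=\min_{1\le k\le n}\frac{2n\pi_k}{L_k+\mu_k}$. Case 2: for each $1\le k\le n$ the cost is $f_k(x)=\frac12 x^\top A_k x+B_k x$ with $A_k\in\mathbb{R}^{d\times d}$ symmetric positive semidefinite and $B_k\in\mathbb{R}^{1\times d}$, and the aggregate cost $f=\frac1n\sum_{k=1}^n f_k$ is $\mu$-strongly convex for some $\mu>0$; put $\alpha_0=\min_{1\le k\le n}\frac{2n\pi_k}{L_k+\epsilon}$, where $\epsilon>0$ is any fixed number and $L_k$ is the largest eigenvalue of $A_k$. Let $x_*$ be the unique minimizer of $f$. Then for every stepsize $\alpha\in(0,\alpha_0]$ and each $1\le k\le n$, the sequence $\{z_k(t)\}$ generated by the gradient-push algorithm with constant stepsize $\alpha$ converges linearly to an $O(\alpha)$-neighborhood of $x_*$. That is, for given initial data there is a constant $K>0$ independent of $\alpha\in(0,\alpha_0]$ and of $t$, and for each $\alpha\in(0,\alpha_0]$ there are constants $M_\alpha>0$ and $r_\alpha\in(0,1)$, such that $$\|z_k(t)-x_*\|\le M_\alpha r_\alpha^{t}+K\alpha\qquad\text{for all } t\ge 1,\ 1\le k\le n.$$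
   Context: Network: $G=(V,E)$ is a strongly connected directed graph on $V=\{1,\dots,n\}$. $W=(W_{ij})$ is a real nonnegative $n\times n$ matrix with $W_{ij}>0$ if $(i,j)\in E$ or $i=j$, and $W_{ij}=0$ otherwise; $W$ is column stochastic, $\sum_{k=1}^n W_{kj}=1$ for all $j$. $\pi=(\pi_1,\dots,\pi_n)^\top$ is the right eigenvector of $W$ with $W\pi=\pi$ and $\sum_j\pi_j=1$ (all $\pi_j>0$). A function is $L$-smooth if it is differentiable and $\|\nabla g(x)-\nabla g(y)\|\le L\|x-y\|$ for all $x,y$. The aggregate cost is $f=\frac1n\sum_{k=1}^n f_k$ on $\mathbb{R}^d$ (it has the same minimizer as $\sum_k f_k$). Gradient-push algorithm with constant stepsize $\alpha>0$: given $x_i(0)\in\mathbb{R}^d$ and $y_i(0)=1$ for $1\le i\le n$, for $t\ge0$, $$w_i(t+1)=\sum_{j=1}^nW_{ij}x_j(t),\quad y_i(t+1)=\sum_{j=1}^nW_{ij}y_j(t),\quad z_i(t+1)=\frac{w_i(t+1)}{y_i(t+1)},\quad x_i(t+1)=w_i(t+1)-\alpha\nabla f_i(z_i(t+1)).$$ *)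

(* Defs.v *)
From mathcomp Require Import all_boot all_order all_algebra.
From mathcomp Require Import all_classical all_reals all_analysis.

Set Implicit Arguments.
Unset Strict Implicit.
Unset Printing Implicit Defensive.

Import Order.TTheory GRing.Theory Num.Theory.
Import numFieldNormedType.Exports.

Local Open Scope ring_scope.

Section Euclidean.
Variables (R : realType) (d : nat).
Implicit Types (x y : 'cV[R]_d) (g : 'cV[R]_d -> R).

(* The norm [`|x|] that the library puts on matrices is the sup norm, hence this
   separate Euclidean norm. The two are equivalent, so [differentiable] means
   the same for both. *)
Definition enorm x : R := Num.sqrt (\sum_(i < d) x i 0 ^+ 2).

Definition grad g x : 'cV[R]_d := \col_(i < d) 'D_(delta_mx i 0) g x.

Definition smooth (L : R) g : Prop :=
  (forall x, differentiable g x) /\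
  (forall x y, enorm (grad g x - grad g y) <= L * enorm (x - y)).

Definition strongly_convex (mu : R) g : Prop :=
  forall x y (t : R), 0 <= t <= 1 ->
    g (t *: x + (1 - t) *: y) <=
      t * g x + (1 - t) * g y - mu / 2 * t * (1 - t) * enorm (x - y) ^+ 2.

Definition minimizer g x : Prop := forall y, g x <= g y.

Definition psd (A : 'M[R]_d) : Prop :=
  A^T = A /\ forall x, 0 <= (x^T *m A *m x) 0 0.

Definition quadratic (A : 'M[R]_d) (B : 'rV[R]_d) x : R :=
  2^-1 * (x^T *m A *m x) 0 0 + (B *m x) 0 0.

Definition largest_eigenvalue (A : 'M[R]_d) (l : R) : Prop :=
  eigenvalue A l /\ forall a, eigenvalue A a -> a <= l.

End Euclidean.

(* The nodes are ['I_n.+1], so that the network is nonempty; the number of nodes,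
   written n in the usual formulas, is [n.+1] here. *)
Section Network.
Variables (R : realType) (n : nat).

Definition min_over (F : 'I_n.+1 -> R) : R := \big[Num.min/F ord0]_(k < n.+1) F k.

Definition strongly_connected (E : rel 'I_n.+1) : Prop :=
  forall i j, connect E i j.

Definition weights_of (E : rel 'I_n.+1) (W : 'M[R]_n.+1) : Prop :=
  forall i j, (E i j || (i == j) -> 0 < W i j) /\
              (~~ (E i j || (i == j)) -> W i j = 0).

Definition column_stochastic (W : 'M[R]_n.+1) : Prop :=
  forall j, \sum_(k < n.+1) W k j = 1.

Definition stationary (W : 'M[R]_n.+1) (pi : 'cV[R]_n.+1) : Prop :=
  W *m pi = pi /\ \sum_(j < n.+1) pi j 0 = 1.

Variable d : nat.
Implicit Types (f : 'I_n.+1 -> 'cV[R]_d -> R) (pi : 'cV[R]_n.+1).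

Definition aggregate f (x : 'cV[R]_d) : R :=
  n.+1%:R^-1 * \sum_(k < n.+1) f k x.

Definition strongly_convex_costs pi f (alpha0 : R) : Prop :=
  exists mu L : 'I_n.+1 -> R,
    [/\ forall k, 0 < mu k,
        forall k, strongly_convex (mu k) (f k),
        forall k, smooth (L k) (f k)
      & alpha0 = min_over (fun k => 2 * n.+1%:R * pi k 0 / (L k + mu k))].

Definition quadratic_costs pi f (alpha0 : R) : Prop :=
  exists (A : 'I_n.+1 -> 'M[R]_d) (B : 'I_n.+1 -> 'rV[R]_d)
         (L : 'I_n.+1 -> R) (mu eps : R),
    [/\ forall k, psd (A k) /\ f k =1 quadratic (A k) (B k),
        0 < mu /\ strongly_convex mu (aggregate f),
        forall k, largest_eigenvalue (A k) (L k),
        0 < eps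
      & alpha0 = min_over (fun k => 2 * n.+1%:R * pi k 0 / (L k + eps))].

(* [w 0] and [z 0] are not defined by the algorithm and are left unconstrained. *)
Definition gradient_push (W : 'M[R]_n.+1) f (alpha : R)
    (x0 : 'I_n.+1 -> 'cV[R]_d) (w x z : nat -> 'I_n.+1 -> 'cV[R]_d)
    (y : nat -> 'I_n.+1 -> R) : Prop :=
  (forall i, x 0%N i = x0 i /\ y 0%N i = 1) /\
  (forall t i,
    [/\ w t.+1 i = \sum_(j < n.+1) W i j *: x t j,
        y t.+1 i = \sum_(j < n.+1) W i j * y t j,
        z t.+1 i = (y t.+1 i)^-1 *: w t.+1 i
      & x t.+1 i = w t.+1 i - alpha *: grad (f i) (z t.+1 i)]).

End Network.

(* Main.v *)
Require Import Defs.
From mathcomp Require Import all_boot all_order all_algebra.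
From mathcomp Require Import all_classical all_reals all_analysis.
From mathcomp Require Import ring lra.

(** Write N for the number of nodes. In the variables u_j = w_j / (N pi_j) the
    algorithm reads
      u_i(t+1) = sum_j P_ij (u_j(t) - (alpha / (N pi_j)) grad f_j (z_j(t))),
    where P_ij = W_ij pi_j / pi_i is row stochastic with invariant weights pi, and
    z_j = u_j / eta_j with eta_j = y_j / (N pi_j). The proof compares this iteration
    with the unperturbed one, in which z_j is replaced by u_j, in the norm
    |u|^2 = sum_i pi_i |u_i|^2.

    Averaging by P does not increase this norm; as W is irreducible with positive
    diagonal, it even decreases its square by a fixed fraction of the variance
    ([variance_decay]). Hence eta converges to 1 geometrically
    ([avg_geometric]), and z - u is a geometrically small multiple of u.

    The unperturbed step contracts squared distances by 1 - c alpha, where c does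
    not depend on alpha. In the strongly convex case each gradient step is already
    a contraction, by the Baillon-Haddad inequality
    ([gradient_step_contraction]). In the quadratic case a gradient step is only
    nonexpansive, but on a difference u of two families the squared norm loses a
    multiple of alpha <A_j u_j, u_j> at each node, the averaging loses a multiple
    of the variance, and the two losses together control alpha |u|^2 because the
    sum of the A_j is positive definite ([quadratic_contracting]).

    The constant family xstar is moved by the unperturbed step by O(alpha), which is
    too much for a contraction rate 1 - c alpha. But the gradients of the f_j at
    xstar sum to zero, so one can solve v - P v = - P h with
    h_j = grad f_j (xstar) / (N pi_j) ([avg_solvable]), and xstar + alpha v is moved by
    O(alpha^2) only. Therefore the iterates approach xstar + alpha v linearly up to
    O(alpha^2) / (c alpha) = O(alpha) ([perturbed_iteration]). *)

Import Order.TTheory GRing.Theory Num.Theory.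
Import numFieldNormedType.Exports.

Set Implicit Arguments.
Unset Strict Implicit.
Unset Printing Implicit Defensive.

Local Open Scope ring_scope.

(** * Semi-inner products *)

(** [B] is a symmetric positive semidefinite bilinear form. Three instances are
    used: the Euclidean product of ['cV_d], the form of a positive semidefinite
    matrix, and the weighted product of families of vectors of ['cV_d]. *)
Definition semi_inner {R : realType} {V : lmodType R} (B : V -> V -> R) : Prop :=
  [/\ forall x y, B x y = B y x,
      forall x y z, B (x + y) z = B x z + B y z,
      forall a x y, B (a *: x) y = a * B x y
    & forall x, 0 <= B x x].

Section SemiInner.
Variables (R : realType) (V : lmodType R) (B : V -> V -> R).
Hypothesis hB : semi_inner B.

Let BC x y : B x y = B y x. Proof. by case: hB. Qed.
Let BDl x y z : B (x + y) z = B x z + B y z. Proof. by case: hB. Qed.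
Let BZl a x y : B (a *: x) y = a * B x y. Proof. by case: hB. Qed.
Let B0 x : 0 <= B x x. Proof. by case: hB. Qed.

Lemma semi_innerDr x y z : B x (y + z) = B x y + B x z.
Proof. by rewrite BC BDl !(BC x). Qed.
Lemma semi_innerZr a x y : B x (a *: y) = a * B x y.
Proof. by rewrite BC BZl BC. Qed.
Lemma semi_innerNl x y : B (- x) y = - B x y.
Proof. by rewrite -scaleN1r BZl mulN1r. Qed.
Lemma semi_innerNr x y : B x (- y) = - B x y.
Proof. by rewrite BC semi_innerNl BC. Qed.
Lemma semi_inner0l x : B 0 x = 0.
Proof. by rewrite -(scale0r 0) BZl mul0r. Qed.

Definition semi_innerE :=
  (BDl, BZl, semi_innerDr, semi_innerZr, semi_innerNl, semi_innerNr).

Lemma semi_inner_sqrD x y : B (x + y) (x + y) = B x x + 2 * B x y + B y y.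
Proof. rewrite !semi_innerE (BC y x); ring. Qed.

Lemma semi_inner_sqrB x y : B (x - y) (x - y) = B x x - 2 * B x y + B y y.
Proof. rewrite !semi_innerE (BC y x); ring. Qed.

Lemma semi_inner_sqrZ a x : B (a *: x) (a *: x) = a ^+ 2 * B x x.
Proof. rewrite !semi_innerE; ring. Qed.

Lemma semi_inner_sqrD_le x y : B (x + y) (x + y) <= 2 * B x x + 2 * B y y.
Proof.
rewrite semi_inner_sqrD; have := B0 (x - y); rewrite semi_inner_sqrB; lra.
Qed.

Lemma semi_inner_CS x y : B x y ^+ 2 <= B x x * B y y.
Proof.
have q (a : R) : 0 <= B x x + 2 * (a * B x y) + a ^+ 2 * B y y.
  by rewrite -semi_inner_sqrZ -semi_innerZr -semi_inner_sqrD.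
case: (ltrgt0P (B y y)) (B0 y) => // [y0 _|y0 _].
  have := q (- (B x y / B y y)).
  have -> : B x x + 2 * (- (B x y / B y y) * B x y) +
     (- (B x y / B y y)) ^+ 2 * B y y = (B x x * B y y - B x y ^+ 2) / B y y.
    by field; rewrite gt_eqF.
  by rewrite pmulr_lge0 ?invr_gt0 // subr_ge0.
rewrite y0 mulr0; case: (eqVneq (B x y) 0) => [->|h]; first by rewrite expr0n.
have := q (- ((B x x + 1) / (2 * B x y))); rewrite y0.
have -> : B x x + 2 * (- ((B x x + 1) / (2 * B x y)) * B x y) +
  (- ((B x x + 1) / (2 * B x y))) ^+ 2 * 0 = -1 by field.
by rewrite lerNr oppr0 ler10.
Qed.

(** The seminorm of a form; [enorm] is the case of the Euclidean product. *)
Definition seminorm x := Num.sqrt (B x x).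

Lemma seminorm_ge0 x : 0 <= seminorm x. Proof. exact: sqrtr_ge0. Qed.

Lemma seminorm_sqr x : seminorm x ^+ 2 = B x x.
Proof. exact: sqr_sqrtr. Qed.

Lemma seminorm_le x c : 0 <= c -> (seminorm x <= c) = (B x x <= c ^+ 2).
Proof. by move=> c0; rewrite -seminorm_sqr ler_sqr ?nnegrE ?seminorm_ge0. Qed.

Lemma seminorm_CS x y : B x y <= seminorm x * seminorm y.
Proof.
apply: (le_trans (ler_norm _)).
rewrite -ler_sqr ?nnegrE ?mulr_ge0 ?seminorm_ge0 //.
by rewrite exprMn !seminorm_sqr real_normK ?num_real // semi_inner_CS.
Qed.

Lemma seminormD x y : seminorm (x + y) <= seminorm x + seminorm y.
Proof.
rewrite seminorm_le ?addr_ge0 ?seminorm_ge0 // semi_inner_sqrD sqrrD.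
rewrite !seminorm_sqr; have := seminorm_CS x y; lra.
Qed.

Lemma seminormZ a x : seminorm (a *: x) = `|a| * seminorm x.
Proof. by rewrite /seminorm semi_inner_sqrZ sqrtrM ?sqr_ge0 // sqrtr_sqr. Qed.

Lemma seminormN x : seminorm (- x) = seminorm x.
Proof. by rewrite -scaleN1r seminormZ normrN normr1 mul1r. Qed.

Lemma seminormB x y : seminorm (x - y) = seminorm (y - x).
Proof. by rewrite -seminormN opprB. Qed.

End SemiInner.

(** * The Euclidean product and quadratic forms *)

Section Dot.
Variables (R : realType) (d : nat).
Implicit Types (x y : 'cV[R]_d) (A : 'M[R]_d).

(** The Euclidean product of column vectors. *)
Definition dot x y : R := \sum_(i < d) x i 0 * y i 0.

Lemma dotE x y : dot x y = (x^T *m y) 0 0.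
Proof. by rewrite mxE; apply: eq_bigr => i _; rewrite mxE. Qed.

Lemma semi_inner_dot : semi_inner dot.
Proof.
split.
- by move=> x y; apply: eq_bigr => i _; rewrite mulrC.
- by move=> x y z; rewrite -big_split; apply: eq_bigr => i _; rewrite !mxE mulrDl.
- by move=> a x y; rewrite mulr_sumr; apply: eq_bigr => i _; rewrite !mxE mulrA.
- by move=> x; apply: sumr_ge0 => i _; rewrite -expr2 sqr_ge0.
Qed.

Lemma enormE x : enorm x = seminorm dot x.
Proof. by congr Num.sqrt; apply: eq_bigr => i _; rewrite expr2. Qed.

Lemma dot_eq0 x : dot x x = 0 -> x = 0.
Proof.
move=> /eqP; rewrite psumr_eq0 => [/allP h|i _]; last by rewrite -expr2 sqr_ge0.
apply/matrixP => i j; rewrite ord1 mxE; apply/eqP.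
by have := h i (mem_index_enum _); rewrite mulf_eq0 orbb.
Qed.

Lemma dot_ones_gt0 : (0 < d)%N -> 0 < dot (const_mx 1) (const_mx 1).
Proof.
move=> d0; rewrite /dot; under eq_bigr do rewrite !mxE mulr1.
by rewrite sumr_const card_ord ltr0n.
Qed.

(** The bilinear form of the matrix [A]. *)
Definition qform A x y : R := (x^T *m A *m y) 0 0.

Lemma qformE A x y : qform A x y = dot x (A *m y).
Proof. by rewrite dotE mulmxA. Qed.

Lemma dot_mulmxC A x y : A^T = A -> dot (A *m x) y = dot x (A *m y).
Proof. by move=> hA; rewrite !dotE trmx_mul hA mulmxA. Qed.

Lemma semi_inner_qform A : psd A -> semi_inner (qform A).
Proof.
have [C D Z _] := semi_inner_dot.
move=> [hA pA]; split => //.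
- by move=> x y; rewrite !qformE -dot_mulmxC // C.
- by move=> x y z; rewrite !qformE D.
- by move=> a x y; rewrite !qformE Z.
Qed.

End Dot.

(** * Gradients of smooth and strongly convex functions *)

Lemma le_of_perturbation (R : realFieldType) (a b c : R) :
  (forall t, 0 < t <= 1 -> a <= b + t * c) -> a <= b.
Proof.
move=> h; case: (lerP a b) => // ab.
have c1 : 0 < 2 * (`|c| + (a - b)) by rewrite mulr_gt0 // ltr_wpDl // subr_gt0.
have := h ((a - b) / (2 * (`|c| + (a - b)))).
have -> : 0 < (a - b) / (2 * (`|c| + (a - b))) <= 1.
  rewrite divr_gt0 ?subr_gt0 //= ler_pdivrMr // mul1r.
  have := normr_ge0 c; lra.
move=> /(_ isT).
have : (a - b) / (2 * (`|c| + (a - b))) * c <= (a - b) / 2; last by lra.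
rewrite mulrAC ler_pdivrMr //.
have := ler_norm c; have : 0 < a - b by lra.
move: (a - b) => e e0 hc.
have : e * c <= e * `|c| by rewrite ler_pM2l.
have : 0 <= e * e by rewrite mulr_ge0 // ltW.
lra.
Qed.

Section Gradient.
Variables (R : realType) (d : nat).
Implicit Types (x v : 'cV[R]_d) (f : 'cV[R]_d -> R).

Lemma derive_grad f x v : differentiable f x -> 'D_v f x = dot (grad f x) v.
Proof.
move=> df; have ev : v = \sum_(i < d) v i 0 *: delta_mx i 0.
  by rewrite [LHS]matrix_sum_delta; apply: eq_bigr => i _; rewrite big_ord1.
rewrite [in LHS]ev deriveE // linear_sum; apply: eq_bigr => i _.
by rewrite linearZ /= mxE deriveE // mulrC.
Qed.

Lemma is_derive_line f x v (t : R) : differentiable f (x + t *: v) ->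
  is_derive t 1 (fun s => f (x + s *: v)) (dot (grad f (x + t *: v)) v).
Proof.
move=> df; have dv := diff_derivable (v := v) df.
have E : (fun h : R => h^-1 *: (f (x + (h *: 1 + t) *: v) - f (x + t *: v))) =
         (fun h => h^-1 *: (f (h *: v + (x + t *: v)) - f (x + t *: v))).
  apply/funext => h; congr (_ *: (f _ - _)).
  by rewrite -[h *: 1]/(h * 1) mulr1 scalerDl addrCA.
split; first by rewrite /derivable /= E.
by rewrite -derive_grad // /derive /= E.
Qed.

(** Mean value theorem on the segment from [x] to [x + v], for [f] corrected by
    its first order expansion at [x] and by the term [k * s ^+ 2]. *)
Lemma line_mean_value f x v (k : R) : (forall y, differentiable f y) ->
  exists2 c : R, 0 < c < 1 &
    f (x + v) - f x - dot (grad f x) v + k =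
    dot (grad f (x + c *: v) - grad f x) v + 2 * k * c.
Proof.
move=> df.
pose g := dot (grad f x) v.
pose phi (s : R) := f (x + s *: v) - g * s + k * s ^+ 2.
have dphi (s : R) :
    is_derive s 1 phi (dot (grad f (x + s *: v)) v - g + 2 * k * s).
  have := is_derive_line (df (x + s *: v)) => dl.
  rewrite /phi; apply: is_derive_eq.
  by rewrite /GRing.scale /=; ring.
have cphi : {within `[0, 1], continuous phi}%classic.
  by apply: derivable_within_continuous => s _; case: (dphi s).
have [c] := MVT ltr01 (fun s _ => dphi s) cphi.
rewrite in_itv /= subr0 mulr1 /phi scale0r addr0 scale1r => c01 e.
exists c => //; rewrite !(semi_innerE (semi_inner_dot R d)) -/g.
move: e; lra.
Qed.

Section Smooth.
Variables (f : 'cV[R]_d -> R) (L : R).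
Hypothesis sf : smooth L f.

Let lip c x v : 0 < c < 1 ->
  `|dot (grad f (x + c *: v) - grad f x) v| <= L * c * dot v v.
Proof.
move=> c01; have D := semi_inner_dot R d.
have n z : dot z v <= L * c * dot v v
    -> - (dot z v) <= L * c * dot v v -> `|dot z v| <= L * c * dot v v.
  by move=> h1 h2; rewrite ler_norml lerNl h1 h2.
have h : enorm (grad f (x + c *: v) - grad f x) * enorm v <= L * c * dot v v.
  have := sf.2 (x + c *: v) x; rewrite addrAC subrr add0r !enormE.
  rewrite seminormZ // gtr0_norm; last by case/andP: c01.
  move=> /(ler_wpM2r (seminorm_ge0 (@dot R d) v)) h; apply: (le_trans h).
  by rewrite -(seminorm_sqr D) expr2 !mulrA.
apply: n; apply: le_trans h; rewrite !enormE.
  exact: seminorm_CS.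
by rewrite -semi_innerNl // -(seminormN D (_ - _)) seminorm_CS.
Qed.

Lemma smooth_upper x v :
  f (x + v) <= f x + dot (grad f x) v + L / 2 * dot v v.
Proof.
have [c c01] := line_mean_value x v (- (L / 2 * dot v v)) sf.1.
have := le_trans (ler_norm _) (lip x v c01); lra.
Qed.

Lemma smooth_lower x v :
  f x + dot (grad f x) v - L / 2 * dot v v <= f (x + v).
Proof.
have [c c01] := line_mean_value x v (L / 2 * dot v v) sf.1.
have := lip x v c01; rewrite ler_norml => /andP[]; lra.
Qed.

Variable mu : R.
Hypothesis cf : strongly_convex mu f.

(** Strong convexity between [x] and [x + t *: v] gives the inequality up to a
    multiple of [t], because [f] is bounded below to second order by smoothness;
    then [t] is arbitrarily small. *)
Lemma strongly_convex_lower x v :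
  f x + dot (grad f x) v + mu / 2 * dot v v <= f (x + v).
Proof.
have D := semi_inner_dot R d.
apply: (@le_of_perturbation _ _ _ ((L + mu) / 2 * dot v v)) => t /andP[t0 t1].
have := cf (x + v) x (t := t); rewrite (ltW t0) t1 => /(_ isT).
have -> : t *: (x + v) + (1 - t) *: x = x + t *: v.
  by rewrite scalerDr scalerBl scale1r addrC addrA subrK.
rewrite [x + v - x]addrAC subrr add0r enormE seminorm_sqr //.
have := smooth_lower x (t *: v).
rewrite !(semi_innerE D) => h1 h2; rewrite -(ler_pM2l t0).
lra.
Qed.

Lemma strong_convexity_le_smoothness : (0 < d)%N -> mu <= L.
Proof.
move=> d0; pose v : 'cV[R]_d := const_mx 1.
have v0 : 0 < dot v v by exact: dot_ones_gt0.
have := le_trans (strongly_convex_lower 0 v) (smooth_upper 0 v).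
by rewrite lerD2l ler_pM2r // ler_pM2r // invr_gt0.
Qed.

(** Baillon-Haddad inequality for the convex function
    [p z = f z - mu / 2 * dot z z], which lies below its tangent plane plus
    [(L - mu) / 2] times the squared distance. *)
Lemma shifted_gradient_cocoercive x y : (0 < d)%N ->
  let D := (grad f x - mu *: x) - (grad f y - mu *: y) in
  dot D D <= (L - mu) * dot D (x - y).
Proof.
move=> d0; have I := semi_inner_dot R d; have [C Dl _ _] := I.
pose M := L - mu; have M0 : 0 <= M by rewrite subr_ge0 strong_convexity_le_smoothness.
pose p z := f z - mu / 2 * dot z z.
pose gp z := grad f z - mu *: z.
have lo a b : p a + dot (gp a) (b - a) <= p b.
  have := strongly_convex_lower a (b - a).
  rewrite [a + (b - a)]addrC subrK /p /gp !(semi_innerE I) (C b a).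
  lra.
have up a b : p b <= p a + dot (gp a) (b - a) + M / 2 * dot (b - a) (b - a).
  have := smooth_upper a (b - a).
  rewrite [a + (b - a)]addrC subrK /p /gp /M !(semi_innerE I) (C b a).
  lra.
(* The tangent plane at [a] and the upper bound at [b] are compared at the
   point [b + s *: e]. *)
have half a b s : p a + dot (gp a) (b - a) +
   (s - M / 2 * s ^+ 2) * dot (gp a - gp b) (gp a - gp b) <= p b.
  set e := gp a - gp b.
  have h1 := lo a (b + s *: e); have := up b (b + s *: e).
  move: h1.
  rewrite [b + _ - b]addrAC subrr add0r -[b + _ - a]addrA [s *: _ - a]addrC addrA.
  rewrite (semi_innerDr I) (semi_inner_sqrZ I) !(semi_innerZr I) => h1 h2.
  have h3 : s * dot e e = s * dot (gp a) e - s * dot (gp b) e.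
    by rewrite -mulrBr -(semi_innerNl I) -Dl.
  move: (le_trans h1 h2) h3; lra.
change (dot (gp x - gp y) (gp x - gp y) <= M * dot (gp x - gp y) (x - y)).
have key s : 2 * (s - M / 2 * s ^+ 2) * dot (gp x - gp y) (gp x - gp y) <=
  dot (gp x - gp y) (x - y).
  have := lerD (half x y s) (half y x s).
  have -> : dot (gp y - gp x) (gp y - gp x) = dot (gp x - gp y) (gp x - gp y).
    by rewrite -[gp y - _]opprB (semi_innerNl I) (semi_innerNr I) opprK.
  have -> : dot (gp x - gp y) (x - y) = - dot (gp x) (y - x) - dot (gp y) (x - y).
    by rewrite -[y - x]opprB (semi_innerNr I) Dl (semi_innerNl I) opprK.
  lra.
move: M0; rewrite le_eqVlt => /predU1P[M0|M0].
  rewrite -M0 mul0r; move: key; rewrite -M0 => key.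
  have D0 : 0 <= dot (gp x - gp y) (gp x - gp y) by case: I.
  move: D0 key; move: (dot (gp x - gp y) _) (dot _ _) => r q q0 key.
  (* Here [L = mu], so that [s] can be taken arbitrarily large. *)
  rewrite leNgt; apply/negP => qp.
  have := key ((`|r| + 1) / q).
  rewrite mul0r mul0r subr0 -mulrA divfK ?gt_eqF //.
  have := ler_norm r; have := normr_ge0 r; lra.
have := ler_wpM2l (ltW M0) (key M^-1).
have -> : M * (2 * (M^-1 - M / 2 * M^-1 ^+ 2) * dot (gp x - gp y) (gp x - gp y)) =
  dot (gp x - gp y) (gp x - gp y) by field; rewrite gt_eqF.
by [].
Qed.

(** With [e] the difference of the shifted gradients, the difference of the two
    steps is [(1 - beta * mu) *: (x - y) - beta *: e]; the cocoercivity absorbs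
    the square of [e] as long as [beta * (L + mu) <= 2]. *)
Lemma gradient_step_contraction x y (beta : R) : (0 < d)%N ->
  0 < mu -> 0 <= beta <= 2 / (L + mu) ->
  let s := (x - beta *: grad f x) - (y - beta *: grad f y) in
  0 <= beta * mu <= 1 /\
  dot s s <= (1 - beta * mu) ^+ 2 * dot (x - y) (x - y).
Proof.
move=> d0 mu0 /andP[b0 bL] s; have I := semi_inner_dot R d.
have C := let: And4 C _ _ _ := I in C.
have mL := strong_convexity_le_smoothness d0.
have Lm : 0 < L + mu by lra.
have bL2 : beta * (L + mu) <= 2 by rewrite -ler_pdivlMr.
have bm : 0 <= beta * mu by rewrite mulr_ge0 // ltW.
have bml : beta * mu <= beta * L by rewrite ler_wpM2l.
split; first by apply/andP; split => //; lra.
have := shifted_gradient_cocoercive x y d0 => /=.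
set e := _ - _ - (_ - _) => he.
have -> : s = (1 - beta * mu) *: (x - y) - beta *: e.
  rewrite /s /e; move: (grad f x) (grad f y) => gx gy.
  by apply/matrixP => i j; rewrite !mxE; ring.
have e0 : 0 <= dot e e by case: I.
have cx : 0 <= dot e (x - y).
  case: (ltrP mu L) => h; first by rewrite -(@pmulr_rge0 _ (L - mu)) ?subr_gt0 // (le_trans e0).
  have Lmu : L = mu by apply/eqP; rewrite eq_le h mL.
  move: he; rewrite Lmu subrr mul0r => he.
  have -> : e = 0 by apply: dot_eq0; apply/eqP; rewrite eq_le he e0.
  by rewrite semi_inner0l.
rewrite (semi_inner_sqrB I) !(semi_inner_sqrZ I) (semi_innerZr I).
rewrite (C _ e) (semi_innerZr I).
suff : beta * (beta * dot e e) <= beta * (2 * ((1 - beta * mu) * dot e (x - y))) by lra.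
apply: ler_wpM2l => //.
apply: le_trans (_ : beta * ((L - mu) * dot e (x - y)) <= _).
  exact: ler_wpM2l.
rewrite !mulrA ler_wpM2r //; lra.
Qed.

End Smooth.
End Gradient.

(** * Quadratic functions and the Rayleigh quotient *)

Section Quadratic.
Variables (R : realType) (d : nat).
Implicit Types (x y v : 'cV[R]_d) (A M : 'M[R]_d) (B : 'rV[R]_d).

Lemma derive_line (f : 'cV[R]_d -> R) x v :
  'D_v f x = 'D_1 (fun s : R => f (x + s *: v)) 0.
Proof.
have E : (fun h : R => h^-1 *: (f (x + (h *: 1 + 0) *: v) - f (x + 0 *: v))) =
         (fun h => h^-1 *: (f (h *: v + x) - f x)).
  apply/funext => h; congr (_ *: (f _ - f _)).
    by rewrite -[h *: 1]/(h * 1) mulr1 addr0 addrC.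
  by rewrite scale0r addr0.
by rewrite /derive /= E.
Qed.

Lemma quadraticD A B x v : A^T = A ->
  quadratic A B (x + v) =
  quadratic A B x + dot (A *m x + B^T) v + 2^-1 * qform A v v.
Proof.
move=> hA; have [C Dl _ _] := semi_inner_dot R d.
rewrite /quadratic -!/(qform A _ _) !qformE !mulmxDr !Dl !(semi_innerDr (semi_inner_dot R d)).
rewrite (C x (A *m v)) (dot_mulmxC v x hA) (C v).
rewrite (_ : (B *m x + B *m v) 0 0 = (B *m x) 0 0 + dot B^T v).
  by field.
by rewrite dotE trmxK mxE.
Qed.

Lemma grad_quadratic A B x : A^T = A -> grad (quadratic A B) x = A *m x + B^T.
Proof.
move=> hA; apply/matrixP => i j; rewrite ord1 mxE derive_line.
set a := RHS.
pose b := 2^-1 * qform A (delta_mx i 0) (delta_mx i 0).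
have -> : (fun s : R => quadratic A B (x + s *: delta_mx i 0)) =
    (fun s : R => quadratic A B x + s * a + s ^+ 2 * b).
  apply/funext => s; rewrite quadraticD // !qformE (semi_innerZr (semi_inner_dot R d)).
  rewrite (_ : dot _ (delta_mx i 0) = a); last first.
    rewrite /dot (bigD1 i) //= [delta_mx i 0 i 0]mxE !eqxx mulr1 big1 ?addr0 // => k ki.
    by rewrite [delta_mx _ _ _ _]mxE (negPf ki) mulr0.
  rewrite -scalemxAr /b qformE !(semi_innerE (semi_inner_dot R d)).
  by field.
rewrite derive_val /GRing.scale /=; ring.
Qed.

(** A crude bound of the form of [M], used where only its finiteness matters. *)
Definition mx_abs_sum M : R := \sum_i \sum_j `|M i j|.

Lemma qform_le_abs M x : qform M x x <= mx_abs_sum M * dot x x.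
Proof.
rewrite qformE /dot mulr_suml; apply: ler_sum => i _.
rewrite mxE mulr_sumr mulr_suml; apply: ler_sum => j _.
rewrite mulrCA; apply: le_trans (ler_norm _) _; rewrite normrM ler_wpM2l //.
have le1 k : x k 0 ^+ 2 <= \sum_i x i 0 * x i 0.
  rewrite (bigD1 k) //= -expr2 lerDl; apply: sumr_ge0 => l _.
  by rewrite -expr2 sqr_ge0.
rewrite ler_norml; have := le1 i; have := le1 j.
have := sqr_ge0 (x i 0 + x j 0); have := sqr_ge0 (x i 0 - x j 0).
move=> *; apply/andP; split; lra.
Qed.

Lemma mx_abs_sum_ge0 M : 0 <= mx_abs_sum M.
Proof. by apply: sumr_ge0 => i _; apply: sumr_ge0. Qed.

(** Cauchy-Schwarz inequality for the form of [A], at [x] and [A *m x]. *)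
Lemma psd_mulmx_sqr A (c : R) x : psd A -> (forall y, qform A y y <= c * dot y y) ->
  dot (A *m x) (A *m x) <= c * qform A x x.
Proof.
move=> pA hc; have Q := semi_inner_qform pA.
have D0 y : 0 <= dot y y by case: (semi_inner_dot R d).
have := semi_inner_CS Q x (A *m x).
rewrite [qform A x (A *m x)]qformE -dot_mulmxC; last by case: pA.
have Q0 : 0 <= qform A x x by case: Q.
move: (hc (A *m x)) (D0 (A *m x)).
set p := dot _ _; set q := qform _ _ _; set r := qform A x x in Q0 *.
move=> h; rewrite le_eqVlt => /predU1P[p0|p0 hpq].
  rewrite -p0 => _; case: (lerP 0 c) => c0; first exact: mulr_ge0.
  have := hc x; rewrite -/r => rx; have := nmulr_rle0 (dot x x) c0.
  rewrite D0 => h0; have -> : r = 0 by apply/eqP; rewrite eq_le Q0 (le_trans rx).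
  by rewrite mulr0.
rewrite -(ler_pM2r p0) -expr2 (le_trans hpq) // mulrAC mulrC ler_wpM2r //.
Qed.

Lemma psd_bound_ge0 A (c : R) : (0 < d)%N -> psd A ->
  (forall y, qform A y y <= c * dot y y) -> 0 <= c.
Proof.
move=> d0 [_ pA] hc; rewrite -(pmulr_lge0 _ (dot_ones_gt0 R d0)).
exact: le_trans (pA _) (hc _).
Qed.

(** The supremum [s] of the Rayleigh quotient is an eigenvalue: otherwise
    [s%:M - A] would be invertible, hence coercive since it is positive
    semidefinite, and [s] would not be the least upper bound. *)
Lemma rayleigh_le A (l : R) x : (0 < d)%N -> psd A ->
  (forall a, eigenvalue A a -> a <= l) -> qform A x x <= l * dot x x.
Proof.
move=> d0 [hA pA] hl; have I := semi_inner_dot R d.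
have D0 y : 0 <= dot y y by case: I.
have Dp y : y != 0 -> 0 < dot y y.
  by move=> y0; rewrite lt_neqAle D0 andbT eq_sym; apply: contra_neq y0 => /dot_eq0.
pose S := [set q | exists2 y : 'cV[R]_d, y != 0 & q = qform A y y / dot y y]%classic.
have S0 : (S !=set0)%classic.
  pose e : 'cV[R]_d := const_mx 1.
  exists (qform A e e / dot e e), e => //; apply/eqP => /matrixP/(_ (Ordinal d0) 0)/eqP.
  by rewrite !mxE oner_eq0.
have Sub : has_ubound S.
  exists (mx_abs_sum A) => _ [y y0 ->].
  by rewrite ler_pdivrMr ?Dp // qform_le_abs.
pose s := sup S.
have hs y : qform A y y <= s * dot y y.
  have [->|y0] := eqVneq y 0.
    by rewrite qformE mulmx0 !(semi_inner0l I) mulr0.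
  by rewrite -ler_pdivrMr ?Dp //; apply: ub_le_sup => //; exists y.
pose B := s%:M - A.
have qB y : qform B y y = s * dot y y - qform A y y.
  by rewrite !qformE mulmxBl mul_scalar_mx !(semi_innerE I).
have pB : psd B.
  split; first by rewrite linearB /= tr_scalar_mx hA.
  by move=> y; rewrite -/(qform B y y) qB subr_ge0.
suff sl : s <= l.
  by apply: le_trans (hs x) _; rewrite ler_wpM2r.
have [/det0P[v v0 vB]|B0] := boolP (\det B == 0).
  apply: hl; apply/eigenvalueP; exists v => //.
  by apply/eqP; rewrite eq_sym -subr_eq0 -mul_mx_scalar -mulmxBr vB.
have Bu : B \in unitmx by rewrite unitmxE unitfE.
pose N := (invmx B)^T *m invmx B.
pose K := (mx_abs_sum N + 1) * (mx_abs_sum B + 1).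
have K0 : 0 < K by rewrite mulr_gt0 // ltr_wpDl // mx_abs_sum_ge0.
have coercive y : dot y y <= K * qform B y y.
  have h1 := psd_mulmx_sqr y pB (qform_le_abs B).
  have h2 := qform_le_abs N (B *m y).
  have h3 : qform N (B *m y) (B *m y) = dot y y.
    rewrite qformE /N -mulmxA mulKmx // dotE mulmxA -trmx_mul mulKmx //.
    by rewrite -dotE.
  rewrite h3 in h2; apply: le_trans h2 _.
  have q0 : 0 <= qform B y y by apply: pB.2.
  have m1 := mx_abs_sum_ge0 N; have m2 := mx_abs_sum_ge0 B.
  apply: le_trans (ler_wpM2l m1 h1) _.
  rewrite /K !mulrA ler_wpM2r // ler_pM //; lra.
have : s <= s - K^-1.
  apply: ge_sup => // _ [y y0 ->].
  rewrite ler_pdivrMr ?Dp //; have := coercive y.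
  rewrite -(ler_pdivrMl _ _ K0) qB; lra.
have : 0 < K^-1 by rewrite invr_gt0.
lra.
Qed.

End Quadratic.

(** * Averaging over the network *)

(** Huygens identity: the weighted mean square distance of [a] to [c]. *)
Lemma sum_sqr_dist (R : realFieldType) (I : finType) (q a : I -> R) (c : R) :
  \sum_j q j = 1 ->
  \sum_j q j * (a j - c) ^+ 2 =
  (\sum_j q j * a j - c) ^+ 2 +
  (\sum_j q j * a j ^+ 2 - (\sum_j q j * a j) ^+ 2).
Proof.
move=> q1.
have -> : \sum_j q j * (a j - c) ^+ 2 =
   \sum_j q j * a j ^+ 2 - 2 * c * (\sum_j q j * a j) + c ^+ 2 * \sum_j q j.
  rewrite !mulr_sumr -sumrB -big_split /=; apply: eq_bigr => j _; ring.
rewrite q1; ring.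
Qed.

Section Perron.
Variables (R : realType) (n : nat) (E : rel 'I_n.+1) (W : 'M[R]_n.+1).
Hypothesis hE : strongly_connected E.
Hypothesis hW : weights_of E W.
Hypothesis hWstoch : column_stochastic W.

Lemma weights_ge0 i j : 0 <= W i j.
Proof.
have [h1 h2] := hW i j; case: (boolP (E i j || (i == j))) => h.
  exact: ltW (h1 h).
by rewrite h2.
Qed.

(** Positivity propagates along the edges of the network. *)
Lemma fixed_vector_gt0 (q : 'I_n.+1 -> R) k : (forall i, 0 <= q i) ->
  (forall i, \sum_j W i j * q j = q i) -> 0 < q k -> forall i, 0 < q i.
Proof.
move=> q0 Wq qk i; have /connectP[s] := hE i k.
elim: s i => [|j s IH] i /=; first by move=> _ <-.
move=> /andP[Eij ps] ls; have qj := IH j ps ls.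
rewrite -Wq (bigD1 j) //= ltr_pwDl //.
  by rewrite mulr_gt0 //; case: (hW i j) => -> //; rewrite Eij.
by apply: sumr_ge0 => l _; rewrite mulr_ge0 // weights_ge0.
Qed.

(** Column stochasticity makes the entrywise absolute value of [pi] fixed by [W]
    too, hence also the nonnegative vector [`|pi| - pi]. If the latter did not
    vanish it would be positive, and all the entries of [pi] negative. *)
Lemma stationary_gt0 (pi : 'cV[R]_n.+1) : stationary W pi -> forall k, 0 < pi k 0.
Proof.
move=> [Wpi pi1].
have Wp i : \sum_j W i j * pi j 0 = pi i 0 by rewrite -[in RHS]Wpi mxE.
have Wabs i : \sum_j W i j * `|pi j 0| = `|pi i 0|.
  have le l : `|pi l 0| <= \sum_j W l j * `|pi j 0|.
    rewrite -[in leLHS]Wp; apply: le_trans (ler_norm_sum _ _ _) _.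
    by apply: ler_sum => j _; rewrite normrM ger0_norm // weights_ge0.
  have eq0 : \sum_l (\sum_j W l j * `|pi j 0| - `|pi l 0|) = 0.
    rewrite sumrB exchange_big /= -sumrB big1 // => j _.
    by rewrite -mulr_suml hWstoch mul1r subrr.
  move/eqP: eq0; rewrite psumr_eq0 => [/allP/(_ i (mem_index_enum _))|l _].
    by rewrite subr_eq0 => /eqP.
  by rewrite subr_ge0.
have pos i : 0 <= pi i 0.
  rewrite leNgt; apply/negP => pi_neg.
  have h j : 0 < `|pi j 0| - pi j 0.
    apply: (@fixed_vector_gt0 (fun j => `|pi j 0| - pi j 0) i) => [l|l|].
    - by rewrite subr_ge0 ler_norm.
    - by under eq_bigr do rewrite mulrBr; rewrite sumrB Wabs Wp.
    - by rewrite subr_gt0 (lt_le_trans pi_neg).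
  have : \sum_j pi j 0 <= 0.
    apply: sumr_le0 => j _; have := h j.
    by case: (leP (pi j 0) 0) => // pj; rewrite gtr0_norm // subrr ltxx.
  by rewrite pi1 ler10.
have [k pk] : exists k, 0 < pi k 0.
  apply/existsP; rewrite -[X in is_true X]negbK negb_exists; apply/negP => /forallP h.
  have : \sum_j pi j 0 <= 0 by apply: sumr_le0 => j _; rewrite leNgt.
  by rewrite pi1 ler10.
exact: (@fixed_vector_gt0 (fun j => pi j 0) k).
Qed.

End Perron.

(** [Q] acts on row vectors [a] by [(a *m Q) i = \sum_j Q j i * a j], which is an
    average of [a]; it preserves the mean of weights [p], and it is irreducible
    with positive diagonal. *)
Definition averaging (R : realType) (n : nat) (p : 'I_n.+1 -> R) (Q : 'M[R]_n.+1) : Prop :=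
  [/\ (forall i, 0 < p i) /\ \sum_i p i = 1,
      forall i j, 0 <= Q i j,
      forall i, \sum_j Q j i = 1,
      forall j, \sum_i Q j i * p i = p j
    & (forall i, 0 < Q i i) /\ forall i j, connect (fun i j => 0 < Q j i) i j].

Section Averaging.
Variables (R : realType) (n : nat) (p : 'I_n.+1 -> R) (Q : 'M[R]_n.+1).
Hypothesis hQ : averaging p Q.

Let p0 i : 0 < p i. Proof. by case: hQ => -[]. Qed.
Let p1 : \sum_i p i = 1. Proof. by case: hQ => -[]. Qed.
Let Q0 i j : 0 <= Q i j. Proof. by case: hQ. Qed.
Let Q1 i : \sum_j Q j i = 1. Proof. by case: hQ. Qed.
Let Qp j : \sum_i Q j i * p i = p j. Proof. by case: hQ. Qed.
Let Qd i : 0 < Q i i. Proof. by case: hQ => _ _ _ _ []. Qed.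
Let Qc i j : connect (fun i j => 0 < Q j i) i j.
Proof. by case: hQ => _ _ _ _ []. Qed.

Implicit Type a : 'I_n.+1 -> R.

(** The average at node [i], for a function instead of a row vector. *)
Definition avg a i : R := \sum_j Q j i * a j.

Lemma avg_mean a : \sum_i p i * avg a i = \sum_i p i * a i.
Proof.
under eq_bigr do rewrite mulr_sumr; rewrite exchange_big /=; apply: eq_bigr => j _.
by rewrite -[p j]Qp mulr_suml; apply: eq_bigr => i _; rewrite mulrA (mulrC (p i)).
Qed.

(** The loss of the [p]-weighted square sum in one averaging. *)
Definition avg_defect a : R := \sum_i p i * \sum_j Q j i * (a j - avg a i) ^+ 2.

Lemma avg_defectE a :
  avg_defect a = \sum_i p i * a i ^+ 2 - \sum_i p i * avg a i ^+ 2.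
Proof.
rewrite -(avg_mean (fun i => a i ^+ 2)) -sumrB; apply: eq_bigr => i _.
by rewrite sum_sqr_dist // subrr expr0n add0r mulrBr.
Qed.

Lemma avg_defect_ge0 a : 0 <= avg_defect a.
Proof.
apply: sumr_ge0 => i _; rewrite mulr_ge0 ?(ltW (p0 i)) //.
by apply: sumr_ge0 => j _; rewrite mulr_ge0 // sqr_ge0.
Qed.

Lemma avg_defect_term a i j : p i * (Q j i * (a j - avg a i) ^+ 2) <= avg_defect a.
Proof.
have s0 k l : 0 <= Q l k * (a l - avg a k) ^+ 2 by rewrite mulr_ge0 // sqr_ge0.
rewrite /avg_defect (bigD1 i) //= -[leLHS]addr0 lerD //.
  rewrite ler_pM2l // (bigD1 j) //= lerDl; exact: sumr_ge0.
apply: sumr_ge0 => k _; rewrite mulr_ge0 ?(ltW (p0 k)) //; exact: sumr_ge0.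
Qed.

(** The positive diagonal makes [avg a i] close to [a i], hence [a i] close to
    [a k] for each neighbour [k]; the bound propagates along paths. *)
Lemma connect_defect i j : exists2 C : R, 0 < C &
  forall a, (a i - a j) ^+ 2 <= C * avg_defect a.
Proof.
have /connectP[s] := Qc i j.
elim: s i => [|k s IH] i /=.
  move=> _ ->; exists 1 => // a; rewrite subrr expr0n mul1r; exact: avg_defect_ge0.
move=> /andP[Qki ps] ls; have [C C0 hC] := IH k ps ls.
have c1 : 0 < p i * Q i i by rewrite mulr_gt0.
have c2 : 0 < p i * Q k i by rewrite mulr_gt0.
exists (4 * (p i * Q i i)^-1 + 4 * (p i * Q k i)^-1 + 2 * C) => [|a].
  by rewrite !addr_gt0 ?mulr_gt0 ?invr_gt0.
have h1 : (a i - avg a i) ^+ 2 <= (p i * Q i i)^-1 * avg_defect a.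
  by rewrite ler_pdivlMl // -mulrA avg_defect_term.
have h2 : (a k - avg a i) ^+ 2 <= (p i * Q k i)^-1 * avg_defect a.
  by rewrite ler_pdivlMl // -mulrA avg_defect_term.
have := hC a; rewrite 2!mulrDl -!mulrA.
move: h1 h2; set X := _^-1 * _; set Y := _^-1 * _; set Z := C * _.
move: (avg a i) => b h1 h2 h3.
have := sqr_ge0 (a i - a k - (a k - a j)).
have := sqr_ge0 (a i - b + (a k - b)).
lra.
Qed.

(** One averaging decreases the square sum by a fixed fraction of the variance. *)
Lemma variance_decay : exists2 delta : R, 0 < delta < 1 &
  forall a, \sum_i p i * avg a i ^+ 2 <= \sum_i p i * a i ^+ 2 -
     delta * \sum_i p i * (a i - \sum_j p j * a j) ^+ 2.
Proof.
have /choice[C hC] : forall ij : 'I_n.+1 * 'I_n.+1, exists C : R, 0 < C /\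
    forall a, (a ij.1 - a ij.2) ^+ 2 <= C * avg_defect a.
  by move=> [i j]; have [C C0 hC] := connect_defect i j; exists C.
pose K := 1 + \sum_ij C ij.
have K1 : 1 < K.
  rewrite /K (bigD1 (ord0, ord0)) //= ltrDl ltr_pwDl //; first by case: (hC (ord0, ord0)).
  by apply: sumr_ge0 => ij _; case: (hC ij) => /ltW.
have K0 : 0 < K by apply: lt_trans K1.
exists K^-1 => [|a]; first by rewrite invr_gt0 K0 invf_lt1.
suff : \sum_i p i * (a i - \sum_j p j * a j) ^+ 2 <= K * avg_defect a.
  by rewrite -ler_pdivrMl // avg_defectE; lra.
rewrite -[leRHS]mul1r -p1 mulr_suml; apply: ler_sum => i _; rewrite ler_pM2l //.
apply: le_trans (_ : \sum_j p j * (a j - a i) ^+ 2 <= _).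
  rewrite (sum_sqr_dist a (a i) p1) -[X in _ <= X + _]sqrrN opprB lerDl.
  have := sum_sqr_dist a (\sum_j p j * a j) p1; rewrite subrr expr0n add0r => <-.
  by apply: sumr_ge0 => j _; rewrite mulr_ge0 ?sqr_ge0 // ltW.
rewrite -[leRHS]mul1r -p1 mulr_suml; apply: ler_sum => j _; rewrite ler_pM2l //.
apply: le_trans (_ : C (j, i) * avg_defect a <= _); first by case: (hC (j, i)) => _ /(_ a).
rewrite ler_wpM2r ?avg_defect_ge0 // /K (bigD1 (j, i)) //=.
have : 0 <= \sum_(k | k != (j, i)) C k by apply: sumr_ge0 => ij _; case: (hC ij) => /ltW.
lra.
Qed.

(** The iterated averages converge geometrically to the mean. *)
Lemma avg_geometric : exists2 sigma : R, 0 < sigma < 1 &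
  forall (a0 : 'I_n.+1 -> R), exists2 C : R, 0 <= C &
  forall a : nat -> 'I_n.+1 -> R, (forall i, a 0%N i = a0 i) ->
    (forall t i, a t.+1 i = avg (a t) i) ->
    forall t i, `|a t i - \sum_j p j * a0 j| <= C * sigma ^+ t.
Proof.
have [delta /andP[d0 d1] hd] := variance_decay.
have d2 : 0 < 1 - delta by rewrite subr_gt0.
exists (Num.sqrt (1 - delta)).
  rewrite sqrtr_gt0 d2 /= -[ltRHS]sqrtr1 ltr_sqrt //; lra.
move=> a0; set m := \sum_j p j * a0 j.
pose V := \sum_i p i * (a0 i - m) ^+ 2.
have V0 : 0 <= V by apply: sumr_ge0 => i _; rewrite mulr_ge0 ?sqr_ge0 // ltW.
exists (\sum_i Num.sqrt (V / p i)); first by apply: sumr_ge0 => i _; rewrite sqrtr_ge0.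
move=> a ea0 ea.
have mean t : \sum_j p j * a t j = m.
  elim: t => [|t IH]; first by apply: eq_bigr => j _; rewrite ea0.
  by rewrite -IH -[RHS]avg_mean; apply: eq_bigr => j _; rewrite ea.
have dec t : \sum_i p i * (a t i - m) ^+ 2 <= (1 - delta) ^+ t * V.
  elim: t => [|t IH]; first by rewrite expr0 mul1r; under eq_bigr do rewrite ea0.
  have := hd (a t); under eq_bigr do rewrite -ea; move=> h.
  rewrite exprS -mulrA; apply: le_trans (ler_wpM2l (ltW d2) IH).
  move: h; rewrite !mean.
  have := sum_sqr_dist (a t) m p1; have := sum_sqr_dist (a t.+1) m p1.
  rewrite !mean subrr; lra.
move=> t i; apply: le_trans (_ : Num.sqrt (V / p i) * Num.sqrt (1 - delta) ^+ t <= _).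
  rewrite -ler_sqr ?nnegrE ?mulr_ge0 ?exprn_ge0 ?sqrtr_ge0 //.
  rewrite exprMn real_normK ?num_real // sqr_sqrtr; last by rewrite divr_ge0 // ltW.
  rewrite exprAC sqr_sqrtr; last exact: ltW.
  rewrite mulrAC ler_pdivlMr // mulrC [leRHS]mulrC; apply: le_trans (dec t).
  rewrite (bigD1 i) //= lerDl; apply: sumr_ge0 => j _.
  by rewrite mulr_ge0 ?sqr_ge0 // ltW.
rewrite ler_wpM2r ?exprn_ge0 ?sqrtr_ge0 // (bigD1 i) //= lerDl.
by apply: sumr_ge0 => j _; rewrite sqrtr_ge0.
Qed.

Lemma avg_ge a c : (forall j, c <= a j) -> forall i, c <= avg a i.
Proof.
move=> ca i; rewrite -[c]mul1r -(Q1 i) mulr_suml; apply: ler_sum => j _.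
exact: ler_wpM2l.
Qed.

Section Vectors.
Variable d : nat.
Implicit Types u v h : 'M[R]_(d, n.+1).

(** A family of vectors indexed by the nodes is a matrix with one column per
    node; this is the [p]-weighted product of two families. *)
Definition wdot u v : R := \sum_i p i * dot (col i u) (col i v).

Lemma semi_inner_wdot : semi_inner wdot.
Proof.
have [C D Z P] := semi_inner_dot R d.
split.
- by move=> u v; apply: eq_bigr => i _; rewrite C.
- move=> u v w; rewrite -big_split; apply: eq_bigr => i _ /=.
  by rewrite linearD /= D mulrDr.
- move=> a u v; rewrite mulr_sumr; apply: eq_bigr => i _.
  by rewrite linearZ /= Z mulrCA.
- by move=> u; apply: sumr_ge0 => i _; rewrite mulr_ge0 // ltW.
Qed.

Lemma wdot_rows u : wdot u u = \sum_k \sum_i p i * u k i ^+ 2.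
Proof.
rewrite exchange_big; apply: eq_bigr => i _; rewrite mulr_sumr.
by apply: eq_bigr => k _; rewrite !mxE expr2.
Qed.

(** The weighted mean of a family, and its deviation from the mean. *)
Definition mean u : 'cV[R]_d := u *m \col_i p i.
Definition dev u := u - mean u *m const_mx 1.

Lemma meanE u k : mean u k 0 = \sum_i p i * u k i.
Proof. by rewrite mxE; apply: eq_bigr => i _; rewrite mxE mulrC. Qed.

Lemma devE u k i : dev u k i = u k i - \sum_j p j * u k j.
Proof. by rewrite 2!mxE mxE big_ord1 meanE !mxE mulr1. Qed.

Lemma mulmx_avgE u k i : (u *m Q) k i = avg (u k) i.
Proof. by rewrite mxE; apply: eq_bigr => j _; rewrite mulrC. Qed.

Lemma mean_avg u : mean (u *m Q) = mean u.
Proof.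
apply/matrixP => k j; rewrite ord1 !meanE; under eq_bigr do rewrite mulmx_avgE.
exact: avg_mean.
Qed.

Lemma wdot_mean_dev u : wdot u u = dot (mean u) (mean u) + wdot (dev u) (dev u).
Proof.
rewrite !wdot_rows /dot -big_split; apply: eq_bigr => k _ /=.
rewrite meanE; under [X in _ = _ + X]eq_bigr do rewrite devE.
by rewrite (sum_sqr_dist _ _ p1) subrr; ring.
Qed.

Lemma wdot_avg_decay : exists2 delta : R, 0 < delta < 1 &
  forall u, wdot (u *m Q) (u *m Q) <= wdot u u - delta * wdot (dev u) (dev u).
Proof.
have [delta d01 hd] := variance_decay; exists delta => // u.
rewrite !wdot_rows mulr_sumr -sumrB; apply: ler_sum => k _.
under eq_bigr do rewrite mulmx_avgE; under [X in _ <= _ - _ * X]eq_bigr do rewrite devE.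
exact: hd.
Qed.

Lemma wdot_avg_le u : wdot (u *m Q) (u *m Q) <= wdot u u.
Proof.
have [delta /andP[d0 _] /(_ u)] := wdot_avg_decay.
have [_ _ _ /(_ (dev u))] := semi_inner_wdot.
by move=> h1; have := mulr_ge0 (ltW d0) h1; lra.
Qed.

End Vectors.

(** The matrix [1 - Q] is singular, but it becomes invertible after adding the
    projection to the mean: a row vector in the kernel has mean zero and is
    invariant under averaging, so it vanishes by the decay of the variance. *)
Lemma avg_solvable d (h : 'M[R]_(d, n.+1)) : mean h = 0 ->
  exists v : 'M[R]_(d, n.+1), v - v *m Q = - (h *m Q).
Proof.
move=> h0.
pose T : 'M[R]_n.+1 := 1%:M - Q + (\col_i p i) *m (const_mx 1 : 'rV[R]_n.+1).
have uT m (u : 'M[R]_(m, n.+1)) : u *m T = u - u *m Q + mean u *m const_mx 1.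
  by rewrite /T mulmxDr mulmxBr mulmx1 mulmxA.
have meanT m (u : 'M[R]_(m, n.+1)) : mean (u *m T) = mean u.
  rewrite uT {1}/mean mulmxDl mulmxBl -!/(mean _) mean_avg subrr add0r /mean.
  rewrite -mulmxA (_ : const_mx 1 *m _ = 1%:M) ?mulmx1 //.
  apply/matrixP => i j; rewrite !ord1 !mxE -[RHS]p1.
  by apply: eq_bigr => k _; rewrite !mxE mul1r.
have Tu : T \in unitmx.
  rewrite unitmxE unitfE; apply/det0P => -[r r0 rT].
  have mr : mean r = 0 by rewrite -meanT rT /mean mul0mx.
  have rQ : r = r *m Q.
    by apply/eqP; rewrite -subr_eq0; move: rT; rewrite uT mr mul0mx addr0 => ->.
  have [delta /andP[d0 _] /(_ r)] := wdot_avg_decay 1.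
  rewrite -rQ (_ : dev r = r); last by rewrite /dev mr mul0mx subr0.
  rewrite lerBrDl gerDr pmulr_rle0 // => w0.
  case/eqP: r0; apply/matrixP => i j; rewrite mxE.
  have : p j * dot (col j r) (col j r) <= 0.
    apply: le_trans w0; rewrite /wdot (bigD1 j) //= lerDl.
    apply: sumr_ge0 => k _; rewrite mulr_ge0 ?(ltW (p0 k)) //.
    by case: (semi_inner_dot R 1).
  rewrite pmulr_rle0 // => rj.
  have /matrixP/(_ i 0) : col j r = 0.
    apply: dot_eq0; apply/eqP; rewrite eq_le rj /=.
    by case: (semi_inner_dot R 1).
  by rewrite !mxE.
exists (- (h *m Q) *m invmx T).
set v := _ *m _; have vT : v *m T = - (h *m Q) by rewrite /v mulmxKV.
have mv : mean v = 0.
  by rewrite -meanT vT {1}/mean mulNmx -/(mean _) mean_avg h0 oppr0.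
by rewrite -vT uT mv mul0mx addr0.
Qed.

End Averaging.

(** * Perturbed contractions *)

(** A contraction with constant term [b], perturbed by geometrically small
    terms, reaches the neighborhood of radius [b / (1 - rho)] linearly. *)
Lemma perturbed_recursion (R : realType) (rho sigma C1 C2 b A : R) :
  0 <= rho < 1 -> 0 < sigma < 1 -> 0 <= C1 -> 0 <= C2 -> 0 <= b ->
  exists M r : R, [/\ 0 <= M, sigma <= r < 1 &
    forall a : nat -> R, a 0%N <= A ->
      (forall t, a t.+1 <= (rho + C1 * sigma ^+ t) * a t + b + C2 * sigma ^+ t) ->
      forall t, a t <= M * r ^+ t + b / (1 - rho)].
Proof.
move=> /andP[rho0 rho1] /andP[s0 s1] C10 C20 b0.
pose B := b / (1 - rho).
have B0 : 0 <= B by rewrite divr_ge0 // subr_ge0 ltW.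
have BE : rho * B + b = B by rewrite /B; field; rewrite gt_eqF // subr_gt0.
pose r := (1 + Num.max rho sigma) / 2.
have [rho_r s_r r1] : [/\ rho < r, sigma < r & r < 1].
  rewrite /r; split.
  - have : rho <= Num.max rho sigma by rewrite le_max lexx.
    lra.
  - have : sigma <= Num.max rho sigma by rewrite le_max lexx orbT.
    lra.
  - have : Num.max rho sigma < 1 by rewrite gt_max rho1.
    lra.
have r0 : 0 < r by apply: lt_trans s_r.
pose C := C1 * B + C2; have C0 : 0 <= C by rewrite addr_ge0 // mulr_ge0.
(* [D] satisfies the recursion with equality, after subtraction of [B]. *)
pose D := fix D (t : nat) : R := if t is t'.+1 then (rho + C1 * sigma ^+ t') * D t' + C * sigma ^+ t'
   else `|A|.
have st t : 0 <= sigma ^+ t by rewrite exprn_ge0 // ltW.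
have factor0 t : 0 <= rho + C1 * sigma ^+ t by rewrite addr_ge0 // mulr_ge0.
have D0 t : 0 <= D t.
  by elim: t => [|t IH] /=; [exact: normr_ge0 | rewrite addr_ge0 // mulr_ge0].
have rp t : 0 < r ^+ t by rewrite exprn_gt0.
pose e := (r - rho) / 2; have e0 : 0 < e by rewrite divr_gt0 // subr_gt0.
have [T hT] : exists T : nat, forall t, (T <= t)%N -> C1 * sigma ^+ t <= e.
  have e' : 0 < e / (C1 + 1) by rewrite divr_gt0 // ltr_wpDl.
  have sn : `|sigma| < 1 by rewrite gtr0_norm.
  have [T _ hT] := @cvgr0_norm_lt _ R^o _ _ _ _ (cvg_expr sn) _ e'.
  exists T => t Tt; have := hT t Tt; rewrite /= ger0_norm // ltr_pdivlMr; last by rewrite ltr_wpDl.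
  rewrite mulrDr mulr1 (mulrC C1) => h; apply: le_trans (ltW h); rewrite lerDl; exact: st.
pose M := \sum_(t < T.+1) D t / r ^+ t + C / e.
have M0 : 0 <= M.
  apply: addr_ge0; last by rewrite divr_ge0 // ltW.
  by apply: sumr_ge0 => t _; rewrite divr_ge0 // ltW.
(* The first term of [M] takes care of the first [T] steps, the second one of
   the later steps, where the factor is at most [rho + e < r]. *)
have early t : (t <= T)%N -> D t <= M * r ^+ t.
  rewrite -ltnS => tT; rewrite -ler_pdivrMr // /M (bigD1 (Ordinal tT)) //= -addrA lerDl.
  apply: addr_ge0; last by rewrite divr_ge0 // ltW.
  by apply: sumr_ge0 => k _; rewrite divr_ge0 // ltW.
have late k : D (T + k)%N <= M * r ^+ (T + k).
  elim: k => [|k IH]; first by rewrite addn0 early.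
  rewrite addnS /= exprS; set t := (T + k)%N in IH *.
  have h1 : (rho + C1 * sigma ^+ t) * D t <= (rho + e) * (M * r ^+ t).
    by apply: ler_pM => //; rewrite lerD2l hT // leq_addr.
  have h2 : C * sigma ^+ t <= e * M * r ^+ t.
    apply: ler_pM => //; last by rewrite lerXn2r ?nnegrE ?ltW.
    rewrite mulrC -ler_pdivrMr // /M lerDr.
    by apply: sumr_ge0 => j _; rewrite divr_ge0 // ltW.
  have -> : M * (r * r ^+ t) = (rho + e) * (M * r ^+ t) + e * M * r ^+ t.
    by rewrite /e; field.
  exact: lerD.
exists M, r; split=> // [|a aA rec t]; first by rewrite ltW.
have aD : a t <= D t + B.
  elim: t => [|t IH] /=.
    by apply: le_trans aA _; rewrite -[A]addr0 lerD // addr0 ler_norm.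
  apply: le_trans (rec t) _.
  have := ler_wpM2l (factor0 t) IH; rewrite /C.
  move: (D t) (sigma ^+ t) => x y; move: BE; lra.
apply: le_trans aD _; rewrite lerD2r.
by case: (leqP t T) => [/early//|/ltnW/subnKC <-]; exact: late.
Qed.

Section PerturbedIteration.
Variables (R : realType) (n d : nat) (p : 'I_n.+1 -> R) (Q : 'M[R]_n.+1).
Hypothesis hQ : averaging p Q.
Implicit Types u v z : 'M[R]_(d, n.+1).

Local Notation wnorm := (seminorm (@wdot R n p d)).
Let I := semi_inner_wdot hQ d.

Lemma wnorm_avg_le u : wnorm (u *m Q) <= wnorm u.
Proof. by rewrite seminorm_le ?seminorm_ge0 // seminorm_sqr // wdot_avg_le. Qed.

Lemma wnorm_le_cols u v (c : R) : 0 <= c ->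
  (forall j, dot (col j u) (col j u) <= c ^+ 2 * dot (col j v) (col j v)) ->
  wnorm u <= c * wnorm v.
Proof.
have p0 j : 0 <= p j by case: hQ => -[/(_ j)/ltW].
move=> c0 h; rewrite seminorm_le ?mulr_ge0 ?seminorm_ge0 // exprMn seminorm_sqr //.
rewrite mulr_sumr; apply: ler_sum => j _; rewrite mulrCA; exact: ler_wpM2l.
Qed.

Lemma enorm_col_le u j : enorm (col j u) <= (\sum_k Num.sqrt (p k)^-1) * wnorm u.
Proof.
have p0 k : 0 < p k by case: hQ => -[].
have D := semi_inner_dot R d.
apply: le_trans (_ : Num.sqrt (p j)^-1 * wnorm u <= _); last first.
  rewrite ler_wpM2r ?seminorm_ge0 // (bigD1 j) //= lerDl.
  by apply: sumr_ge0 => k _; exact: sqrtr_ge0.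
rewrite enormE seminorm_le ?mulr_ge0 ?sqrtr_ge0 ?seminorm_ge0 //.
rewrite exprMn sqr_sqrtr; last by rewrite invr_ge0 ltW.
rewrite (seminorm_sqr I) ler_pdivlMl //.
rewrite /wdot (bigD1 j) //= lerDl; apply: sumr_ge0 => k _.
by rewrite mulr_ge0 ?(ltW (p0 k)) //; case: D.
Qed.

Variables (F : 'M[R]_(d, n.+1) -> 'M[R]_(d, n.+1)) (x : 'cV[R]_d).
Variables (Lam c alpha0 : R).
Let us : 'M[R]_(d, n.+1) := x *m const_mx 1.
Hypothesis Lam0 : 0 <= Lam.
Hypothesis F_lip : forall u v, wnorm (F u - F v) <= Lam * wnorm (u - v).
Hypothesis F_mean : mean p (F us) = 0.
Hypothesis c0 : 0 < c.
Hypothesis F_contr : forall alpha, 0 < alpha <= alpha0 -> c * alpha <= 1 /\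
  forall u v,
    wdot p (((u - alpha *: F u) - (v - alpha *: F v)) *m Q)
           (((u - alpha *: F u) - (v - alpha *: F v)) *m Q)
      <= (1 - c * alpha) * wdot p (u - v) (u - v).

(** With [us] the constant family [x], the family [w = us + alpha *: v], where
    [v - v *m Q = - F us *m Q], is moved by the unperturbed step by [O(alpha ^ 2)]
    only, while this step contracts distances by [1 - c * alpha / 2]. So the
    iterates reach an [O(alpha)]-neighborhood of [w], whence of [us]. *)
Lemma perturbed_iteration (U0 : 'M[R]_(d, n.+1)) (sigma C : R) :
  0 < sigma < 1 -> 0 <= C ->
  exists2 K : R, 0 <= K & forall alpha, 0 < alpha <= alpha0 ->
    exists M r : R, [/\ 0 <= M, 0 < r < 1 &
      forall (u z : nat -> 'M[R]_(d, n.+1)) (theta : nat -> 'I_n.+1 -> R),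
        u 0%N = U0 ->
        (forall t, u t.+1 = (u t - alpha *: F (z t)) *m Q) ->
        (forall t j, col j (z t) = theta t j *: col j (u t)) ->
        (forall t j, `|theta t j - 1| <= C * sigma ^+ t) ->
        forall t, wnorm (z t - us) <= M * r ^+ t + K * alpha].
Proof.
move=> s01 C0; have /andP[s0 s1] := s01.
have usQ : us *m Q = us.
  rewrite /us -mulmxA; congr (_ *m _); apply/matrixP => i j; rewrite !mxE.
  under eq_bigr do rewrite mxE mul1r.
  by case: hQ.
have [v hv] := avg_solvable hQ F_mean.
pose V := wnorm v; have V0 : 0 <= V by exact: seminorm_ge0.
exists (2 * Lam * V / c + V).
  by rewrite addr_ge0 // divr_ge0 ?(ltW c0) // !mulr_ge0.
move=> alpha ha; have /andP[a0 a1] := ha; have [ca1 contr] := F_contr ha.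
have ca0 : 0 < c * alpha by rewrite mulr_gt0.
pose X := wnorm us + alpha * V.
have X0 : 0 <= X by rewrite addr_ge0 ?seminorm_ge0 // mulr_ge0 // ltW.
pose b := alpha * (Lam * (alpha * V)).
have aL0 : 0 <= alpha * Lam by rewrite mulr_ge0 // ltW.
have b0 : 0 <= b by rewrite /b mulrA !mulr_ge0 // ltW.
pose w := us + alpha *: v.
have [|||M [r [M0 /andP[sr r1] rec]]] := @perturbed_recursion R (1 - c * alpha / 2) sigma
    (alpha * Lam * C) (alpha * Lam * C * X) b (wnorm (U0 - w)) _ s01 _ _ b0.
- by apply/andP; split; lra.
- by rewrite mulr_ge0.
- by rewrite !mulr_ge0 // ltW.
have r0 : 0 < r by apply: lt_le_trans sr.
pose B := b / (1 - (1 - c * alpha / 2)).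
have BE : B = 2 * Lam * V / c * alpha.
  by rewrite /B /b; field; rewrite !gt_eqF // ?mulr_gt0 //; lra.
have B0 : 0 <= B by rewrite divr_ge0 //; lra.
exists (C * (M + B + X) + M), r; split.
- by rewrite addr_ge0 // mulr_ge0 // addr_ge0 // addr_ge0.
- by rewrite r0.
move=> u z theta u0 iter zu th.
have wE t : wnorm (u t) <= wnorm (u t - w) + X.
  rewrite -{1}(subrK w (u t)); apply: le_trans (seminormD I _ _) _; rewrite lerD2l.
  apply: le_trans (seminormD I _ _) _; rewrite seminormZ // gtr0_norm //.
have zuE t : wnorm (z t - u t) <= C * sigma ^+ t * wnorm (u t).
  apply: wnorm_le_cols => [|j]; first by rewrite mulr_ge0 // exprn_ge0 // ltW.
  have -> : col j (z t - u t) = (theta t j - 1) *: col j (u t).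
    by rewrite linearB /= zu scalerBl scale1r.
  rewrite (semi_inner_sqrZ (semi_inner_dot R d)) ler_wpM2r //.
    by case: (semi_inner_dot R d).
  rewrite -real_normK ?num_real // ler_sqr ?nnegrE //.
  by rewrite mulr_ge0 // exprn_ge0 // ltW.
have residual : wnorm ((w - alpha *: F w) *m Q - w) <= b.
  have -> : (w - alpha *: F w) *m Q - w = (alpha *: (F us - F w)) *m Q.
    rewrite /w mulmxBl mulmxDl usQ -!scalemxAl mulmxBl scalerBr.
    have -> : v *m Q = v + F us *m Q by rewrite -[F us *m Q]opprK -hv opprB addrC subrK.
    apply/matrixP => i j; rewrite !mxE; ring.
  apply: le_trans (wnorm_avg_le _) _; rewrite seminormZ // gtr0_norm // /b ler_pM2l //.
  apply: le_trans (F_lip _ _) _; rewrite ler_wpM2l //.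
  by rewrite /w opprD addrA subrr add0r seminormN // seminormZ // gtr0_norm.
have step t : wnorm (u t.+1 - w) <= (1 - c * alpha / 2 + alpha * Lam * C * sigma ^+ t) *
     wnorm (u t - w) + b + alpha * Lam * C * X * sigma ^+ t.
  pose s := (u t - alpha *: F (u t)) - (w - alpha *: F w).
  have -> : u t.+1 - w = s *m Q + ((w - alpha *: F w) *m Q - w) +
      (alpha *: (F (u t) - F (z t))) *m Q.
    rewrite iter /s addrA -mulmxDl subrK addrAC -mulmxDl; congr (_ *m _ - _).
    by rewrite scalerBr addrA subrK.
  apply: le_trans (seminormD I _ _) _.
  have h1 : wnorm (s *m Q) <= (1 - c * alpha / 2) * wnorm (u t - w).
    rewrite seminorm_le ?mulr_ge0 ?seminorm_ge0 //; last by lra.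
    apply: le_trans (contr _ _) _; rewrite exprMn seminorm_sqr //.
    rewrite ler_wpM2r //; first by case: I.
    have := sqr_ge0 (c * alpha / 2); lra.
  have h2 : wnorm ((alpha *: (F (u t) - F (z t))) *m Q) <=
      alpha * Lam * C * sigma ^+ t * (wnorm (u t - w) + X).
    apply: le_trans (wnorm_avg_le _) _; rewrite seminormZ // gtr0_norm // -!mulrA.
    rewrite ler_pM2l //; apply: le_trans (F_lip _ _) _; rewrite ler_wpM2l //.
    rewrite seminormB //; apply: le_trans (zuE t) _; rewrite -mulrA ler_wpM2l //.
    by rewrite ler_wpM2l ?exprn_ge0 // ltW.
  have := seminormD I (s *m Q) ((w - alpha *: F w) *m Q - w).
  move: h1 h2 residual; lra.
have at_ := rec (fun t => wnorm (u t - w)) _ step.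
move=> t; have {at_}atw : wnorm (u t - w) <= M * r ^+ t + B.
  by apply: at_; rewrite u0.
have rt : 0 <= r ^+ t <= 1 by rewrite exprn_ge0 ?exprn_ile1 // ltW.
have srt : sigma ^+ t <= r ^+ t by apply: lerXn2r; rewrite ?nnegrE // ltW.
have -> : z t - us = (z t - u t) + ((u t - w) + alpha *: v).
  by rewrite /w; apply/matrixP => i j; rewrite !mxE; ring.
apply: le_trans (seminormD I _ _) _.
have h1 := seminormD I (u t - w) (alpha *: v).
rewrite [X in _ <= _ + X]seminormZ // gtr0_norm // -/V in h1.
have h2 : wnorm (z t - u t) <= C * (M + B + X) * r ^+ t.
  apply: le_trans (zuE t) _; rewrite mulrAC ler_pM // ?mulr_ge0 ?seminorm_ge0 //.
    by rewrite exprn_ge0 // ltW.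
  rewrite ler_wpM2l //; apply: le_trans (wE t) _; rewrite lerD2r.
  apply: le_trans atw _; rewrite lerD2r -[leRHS]mulr1 ler_wpM2l //.
  by case/andP: rt.
move: h1 h2 atw; rewrite BE; lra.
Qed.

End PerturbedIteration.

(** * The gradient step of each node *)

Lemma pos_lower_bound (R : realFieldType) (I : finType) (F : I -> R) :
  (forall k, 0 < F k) -> exists2 c : R, 0 < c & forall k, c <= F k.
Proof.
move=> F0; pose S := 1 + \sum_k (F k)^-1.
have s0 (P : pred I) : 0 <= \sum_(k | P k) (F k)^-1.
  by apply: sumr_ge0 => k _; rewrite invr_ge0 ltW.
have S0 : 0 < S by rewrite ltr_pwDl // s0.
exists S^-1 => [|k]; first by rewrite invr_gt0.
rewrite -[leRHS]invrK lef_pV2 ?posrE ?invr_gt0 // /S (bigD1 k) //=.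
by have := s0 (fun i => i != k); lra.
Qed.

Section Steps.
Variables (R : realType) (n d : nat) (p : 'I_n.+1 -> R) (Q : 'M[R]_n.+1).
Hypothesis hQ : averaging p Q.
Implicit Types u v e : 'M[R]_(d, n.+1).
Implicit Type G : 'I_n.+1 -> 'cV[R]_d -> 'cV[R]_d.

Let p0 j : 0 < p j. Proof. by case: hQ => -[]. Qed.
Let N0 : 0 < n.+1%:R :> R. Proof. exact: ltr0Sn. Qed.
Let D := semi_inner_dot R d.
Let D0 (x : 'cV[R]_d) : 0 <= dot x x. Proof. by case: D. Qed.

(** In the variables [u j = node_weight j *: w j], node [j] makes a gradient step
    of size [alpha * node_weight j]. *)
Definition node_weight j : R := (n.+1%:R * p j)^-1.

Lemma node_weight_gt0 j : 0 < node_weight j.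
Proof. by rewrite invr_gt0 mulr_gt0. Qed.

Lemma node_weightK j : p j * node_weight j = n.+1%:R^-1.
Proof. by rewrite /node_weight; field; rewrite !gt_eqF. Qed.

(** The gradients [G j], at the columns of [u], scaled by the node weights. *)
Definition scaled_grad G u : 'M[R]_(d, n.+1) :=
  \matrix_(k, j) (node_weight j * G j (col j u) k 0).

Lemma col_scaled_grad G u j : col j (scaled_grad G u) = node_weight j *: G j (col j u).
Proof. by apply/matrixP => k l; rewrite !mxE ord1. Qed.

Lemma colB u v j : col j (u - v) = col j u - col j v.
Proof. by apply/matrixP => k l; rewrite !mxE. Qed.

Lemma eq_cols u v : (forall j, col j u = col j v) -> u = v.
Proof.
by move=> h; apply/matrixP => k j; have /matrixP/(_ k 0) := h j; rewrite !mxE.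
Qed.

(** The gradient step followed by averaging contracts squared distances by
    [1 - c * alpha], with [c] independent of [alpha]. *)
Definition contracting_steps G (c alpha0 : R) : Prop :=
  forall alpha, 0 < alpha <= alpha0 -> c * alpha <= 1 /\
  forall u v,
    wdot p (((u - alpha *: scaled_grad G u) - (v - alpha *: scaled_grad G v)) *m Q)
           (((u - alpha *: scaled_grad G u) - (v - alpha *: scaled_grad G v)) *m Q)
      <= (1 - c * alpha) * wdot p (u - v) (u - v).

Lemma col_step G u v (alpha : R) j :
  col j ((u - alpha *: scaled_grad G u) - (v - alpha *: scaled_grad G v)) =
  (col j u - (alpha * node_weight j) *: G j (col j u)) -
  (col j v - (alpha * node_weight j) *: G j (col j v)).
Proof. by apply/matrixP => k l; rewrite !mxE ord1; ring. Qed.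

Lemma step_size_le (alpha b : R) j : 0 < b ->
  alpha <= 2 * n.+1%:R * p j / b -> alpha * node_weight j <= 2 / b.
Proof.
move=> b0 h; rewrite /node_weight ler_pdivrMr ?mulr_gt0 //.
by rewrite mulrAC [2 * _]mulrA.
Qed.

(** Here each node contracts, and averaging is nonexpansive. *)
Lemma strongly_convex_contracting (f : 'I_n.+1 -> 'cV[R]_d -> R) (mu L : 'I_n.+1 -> R) :
  (0 < d)%N -> (forall k, 0 < mu k) -> (forall k, strongly_convex (mu k) (f k)) ->
  (forall k, smooth (L k) (f k)) ->
  exists2 c : R, 0 < c & contracting_steps (fun k => grad (f k)) c
     (min_over (fun k => 2 * n.+1%:R * p k / (L k + mu k))).
Proof.
move=> d0 mu0 cf sf.
have [c c0 hc] := @pos_lower_bound R _ (fun k => node_weight k * mu k)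
  (fun k => mulr_gt0 (node_weight_gt0 k) (mu0 k)).
exists c => // alpha /andP[al0 al1].
have Lmu k : 0 < L k + mu k.
  by have := strong_convexity_le_smoothness (sf k) (cf k) d0; have := mu0 k; lra.
have beta k : 0 <= alpha * node_weight k <= 2 / (L k + mu k).
  rewrite mulr_ge0 ?(ltW al0) ?(ltW (node_weight_gt0 k)) //=.
  apply: step_size_le => //; apply: le_trans al1 _.
  exact: bigmin_le.
have step k x y := gradient_step_contraction (sf k) (cf k) x y d0 (mu0 k) (beta k).
have cal k : c * alpha <= alpha * node_weight k * mu k.
  by rewrite mulrC -mulrA ler_pM2l.
split; first by have [/andP[_ h] _] := step ord0 0 0; exact: le_trans (cal ord0) h.
move=> u v; apply: le_trans (wdot_avg_le hQ _) _.
rewrite mulr_sumr; apply: ler_sum => j _; rewrite mulrCA ler_pM2l //.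
rewrite col_step; have [/andP[h0 h1] h] := step j (col j u) (col j v).
rewrite colB; apply: le_trans h _; rewrite ler_wpM2r //.
have := cal j; move: h0 h1; set b := alpha * _ * _ => h0 h1 h2.
have : 0 <= b * (1 - b) by rewrite mulr_ge0 // subr_ge0.
lra.
Qed.

Lemma dev_linearB u v : dev p (u - v) = dev p u - dev p v.
Proof.
rewrite /dev /mean !mulmxBl; move: (_ *m _ *m _) (_ *m _ *m _) => a b.
by apply/matrixP => k j; rewrite !mxE; ring.
Qed.

(** On the differences [e = u - v] the step is linear: [s = e - g]. It decreases
    the squared norm by a multiple of [alpha * \sum_j q j], where [q j] is the
    form of [A j] at the column [j] of [e], and averaging decreases it further by a
    multiple of the variance of [s]. Together they dominate the variance [V] of
    [e], and its mean [m] by the coercivity of the sum of the forms. *)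
Lemma quadratic_contracting (A : 'I_n.+1 -> 'M[R]_d) (B : 'I_n.+1 -> 'rV[R]_d)
    (L : 'I_n.+1 -> R) (mu eps : R) :
  (0 < d)%N -> (forall k, psd (A k)) ->
  (forall k x, qform (A k) x x <= L k * dot x x) ->
  0 < mu -> (forall x, n.+1%:R * mu * dot x x <= \sum_k qform (A k) x x) ->
  0 < eps ->
  let alpha0 := min_over (fun k => 2 * n.+1%:R * p k / (L k + eps)) in
  0 < alpha0 ->
  exists2 c : R, 0 < c & contracting_steps (fun k x => A k *m x + (B k)^T) c alpha0.
Proof.
move=> d0 pA hL mu0 hmu eps0 alpha0 al0.
have L0 k : 0 <= L k by exact: psd_bound_ge0 d0 (pA k) (hL k).
have Le k : 0 < L k + eps by rewrite ltr_wpDl.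
have [kappa k0 hk] := @pos_lower_bound R _ (fun k => 2 * eps / (L k + eps))
  (fun k => divr_gt0 (mulr_gt0 (ltr0Sn R 1) eps0) (Le k)).
have [delta /andP[de0 _] hd] := wdot_avg_decay hQ d.
have [del' dl0 [dl1 dl2 dl3]] : exists2 x : R, 0 < x & [/\ x <= delta, x <= kappa / 4 & x <= 1].
  exists (Num.min delta (Num.min (kappa / 4) 1)).
    by rewrite !lt_min de0 ltr01 divr_gt0.
  by rewrite !ge_min !lexx !orbT.
pose La := \sum_k L k / p k.
have La0 : 0 <= La by apply: sumr_ge0 => k _; rewrite divr_ge0 // ltW.
have den0 : 0 < del' + 2 * kappa * alpha0 * La.
  by rewrite ltr_pwDl // !mulr_ge0 // ltW.
(* [th] balances two losses: only the fraction [th] of the lower bound of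
   [\sum_j q j] is used, so that its error [La * V] is absorbed by the
   variance term, uniformly for [alpha <= alpha0]. *)
pose th := del' / (del' + 2 * kappa * alpha0 * La).
have th0 : 0 < th by rewrite divr_gt0.
have thE : th * (2 * kappa * alpha0 * La) = del' - th * del'.
  by rewrite /th; field; rewrite gt_eqF.
have th1 : th <= 1.
  by rewrite /th ler_pdivrMr // mul1r lerDl !mulr_ge0 // ltW.
have [c c0 [c1 c2]] : exists2 c : R, 0 < c & c <= kappa * th * mu / 4 /\ c <= del' / (4 * alpha0).
  exists (Num.min (kappa * th * mu / 4) (del' / (4 * alpha0))).
    by rewrite lt_min !(divr_gt0, mulr_gt0).
  by rewrite !ge_min !lexx !orbT.
exists c => // alpha /andP[a0 a1].
have ca : c * alpha <= del' / 4.
  apply: le_trans (_ : c * alpha0 <= _); first by rewrite ler_pM2l.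
  by rewrite -ler_pdivlMr // -mulrA -invfM.
split; first by lra.
move=> u v; set s := _ - _ - (_ - _); pose e := u - v.
pose b j := alpha * node_weight j.
have b0 j : 0 < b j by rewrite mulr_gt0 // node_weight_gt0.
have bE j : b j = alpha * node_weight j by [].
clearbody b.
pose g : 'M[R]_(d, n.+1) := \matrix_(k, j) (b j *: (A j *m col j e)) k 0.
have colg j : col j g = b j *: (A j *m col j e).
  by apply/matrixP => k l; rewrite !mxE ord1.
have sE : s = e - g.
  apply: eq_cols => j; rewrite /s col_step colB colg /e colB mulmxBr -bE.
  move: (A j *m _) (A j *m _) => x y.
  by apply/matrixP => k l; rewrite !mxE; ring.
pose q j := qform (A j) (col j e) (col j e).
have q0 j : 0 <= q j by apply: (pA j).2.
have bL j : b j * (L j + eps) <= 2.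
  rewrite -ler_pdivlMr // bE; apply: step_size_le => //; apply: le_trans a1 _.
  exact: bigmin_le.
have Aq j : dot (A j *m col j e) (A j *m col j e) <= L j * q j.
  exact: psd_mulmx_sqr (pA j) (hL j).
pose tau := alpha / n.+1%:R; have tau0 : 0 < tau by rewrite divr_gt0.
have tauE : tau = alpha / n.+1%:R by [].
clearbody tau.
have pb j : p j * b j = tau by rewrite bE tauE mulrCA node_weightK.
have gg : wdot p g g <= 2 * tau * \sum_j q j.
  rewrite mulr_sumr; apply: ler_sum => j _.
  rewrite colg (semi_inner_sqrZ D) expr2 !mulrA pb [2 * tau]mulrC -!mulrA ler_pM2l //.
  apply: le_trans (ler_wpM2l (ltW (b0 j)) (Aq j)) _; rewrite mulrA ler_wpM2r //.
  have := bL j; have := mulr_gt0 (b0 j) eps0; lra.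
have ss : wdot p s s <= wdot p e e - kappa * tau * \sum_j q j.
  rewrite mulr_sumr -sumrB; apply: ler_sum => j _.
  rewrite -(pb j) [p j * b j]mulrC !mulrA [kappa * _ * p j]mulrC -!mulrA -mulrBr ler_pM2l //.
  rewrite sE colB colg (semi_inner_sqrB D) (semi_inner_sqrZ D) (semi_innerZr D) -qformE -/(q j).
  have h1 : b j ^+ 2 * dot (A j *m col j e) (A j *m col j e) <= b j * (b j * L j * q j).
    rewrite expr2 -!mulrA !ler_pM2l //; exact: Aq.
  have h2 : kappa <= 2 - b j * L j.
    apply: le_trans (hk j) _; rewrite ler_pdivrMr //.
    have := ler_wpM2r (L0 j) (bL j); lra.
  have := ler_wpM2l (ltW (b0 j)) (ler_wpM2r (q0 j) h2); move: h1; lra.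
have I := semi_inner_wdot hQ d.
have W0 (w : 'M[R]_(d, n.+1)) : 0 <= wdot p w w by case: I => _ _ _; apply.
have devg : wdot p (dev p g) (dev p g) <= wdot p g g.
  by rewrite [leRHS](wdot_mean_dev hQ) lerDr.
have deve : wdot p (dev p e) (dev p e) <=
    2 * wdot p (dev p s) (dev p s) + 2 * wdot p (dev p g) (dev p g).
  have -> : dev p e = dev p s + dev p g by rewrite sE dev_linearB subrK.
  exact: semi_inner_sqrD_le.
pose m := mean p e; pose V := wdot p (dev p e) (dev p e).
have V0 : 0 <= V by exact: W0.
have qlow : n.+1%:R * mu * dot m m <= 2 * (\sum_j q j) + 2 * (La * V).
  apply: le_trans (hmu m) _.
  have -> : 2 * (\sum_j q j) + 2 * (La * V) = \sum_j (2 * q j + 2 * (L j / p j * V)).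
    by rewrite big_split /= -!mulr_sumr mulr_suml.
  apply: ler_sum => j _.
  have QI := semi_inner_qform (pA j).
  have -> : m = col j e - col j (dev p e).
    by rewrite /dev /m; apply/matrixP => k l; rewrite ord1 !mxE big_ord1 !mxE mulr1; ring.
  apply: le_trans (semi_inner_sqrD_le QI _ _) _.
  rewrite (semi_innerNl QI) (semi_innerNr QI) opprK lerD2l ler_pM2l //.
  apply: le_trans (hL j _) _; rewrite -mulrA ler_wpM2l // ler_pdivlMl //.
  rewrite /V /wdot (bigD1 j) //= lerDl; apply: sumr_ge0 => k _.
  by rewrite mulr_ge0 ?(ltW (p0 k)).
have S0 : 0 <= \sum_j q j by apply: sumr_ge0.
rewrite -/e; apply: le_trans (hd s) _.
have ee : wdot p e e = dot m m + V by rewrite (wdot_mean_dev hQ).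
have h1 : del' * wdot p (dev p s) (dev p s) <= delta * wdot p (dev p s) (dev p s).
  exact: ler_wpM2r.
rewrite ee; have mm0 := D0 m.
have W1 := W0 (dev p s).
have tau_le : tau <= alpha0.
  by apply: le_trans a1; rewrite tauE ler_pdivrMr // ler_peMr ?ler1n // ltW.
have tN : tau * n.+1%:R = alpha by rewrite tauE divfK // gt_eqF.
move: gg ss devg deve qlow h1; rewrite ee -/V.
move: (\sum_j q j) S0 (wdot p (dev p s) _) (wdot p (dev p g) _) (wdot p g g) (wdot p s s).
move: (dot m m) mm0 => mm mm0 S S0 X Y Z T gg ss devg deve qlow h1.
have h2 : del' * (V / 2 - 2 * tau * S) <= del' * X by rewrite ler_pM2l //; lra.
have tS : 0 <= tau * S by rewrite mulr_ge0 // ltW.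
have h3 := ler_wpM2r tS dl2.
have h4 : th * (kappa * (tau * S)) <= kappa * (tau * S).
  by rewrite ler_piMl // mulr_ge0 // ltW.
have w0 : 0 <= kappa * tau * th / 4.
  by have := mulr_gt0 (mulr_gt0 k0 tau0) th0; lra.
have h5 := ler_wpM2l w0 qlow.
have h5' : kappa * tau * th / 4 * (n.+1%:R * mu * mm) = kappa * th * mu / 4 * (alpha * mm).
  by rewrite -tN; ring.
have h6 : kappa * tau * th * La <= del' / 2.
  have h : kappa * th * La * tau <= kappa * th * La * alpha0.
    by rewrite ler_wpM2l // mulr_ge0 // ltW // mulr_gt0.
  have := mulr_ge0 (ltW th0) (ltW dl0); move: h thE; lra.
have h7 := ler_wpM2r V0 h6.
have h8 : c * (alpha * mm) <= kappa * th * mu / 4 * (alpha * mm).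
  by rewrite ler_wpM2r // mulr_ge0 // ltW.
have h9 := ler_wpM2r V0 ca.
rewrite h5' in h5.
move: h1 h2 h3 h4 h5 h7 h8 h9 ss; lra.
Qed.

End Steps.

(** * Gradient-push *)

Section Network.
Variables (R : realType) (n d : nat) (E : rel 'I_n.+1) (W : 'M[R]_n.+1).
Variable pi : 'cV[R]_n.+1.
Hypothesis hE : strongly_connected E.
Hypothesis hW : weights_of E W.
Hypothesis hWstoch : column_stochastic W.
Hypothesis hpi : stationary W pi.

Let p j := pi j 0.
Let p0 j : 0 < p j. Proof. exact: (stationary_gt0 hE hW hWstoch hpi). Qed.
Let N0 : 0 < n.+1%:R :> R. Proof. exact: ltr0Sn. Qed.

(** The action of [W] in the variables [w j / pi j]. *)
Definition averaging_of : 'M[R]_n.+1 := \matrix_(j, i) (W i j * pi j 0 / pi i 0).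

Lemma averaging_ofP : averaging p averaging_of.
Proof.
have [Wpi pi1] := hpi.
split; first by [].
- move=> i j; rewrite mxE divr_ge0 ?(ltW (p0 j)) // mulr_ge0 ?(ltW (p0 i)) //.
  exact: weights_ge0 hW _ _.
- move=> i; under eq_bigr do rewrite mxE; rewrite -mulr_suml.
  rewrite (_ : \sum_j _ = p i) ?divff ?gt_eqF //.
  by rewrite /p -[in RHS]Wpi mxE.
- move=> j; rewrite -[RHS]mul1r -(hWstoch j) mulr_suml; apply: eq_bigr => i _.
  by rewrite mxE divfK // gt_eqF // p0.
have Wp i j : E i j || (i == j) -> 0 < W i j by case: (hW i j).
have Qp i j : E i j || (i == j) -> 0 < averaging_of j i.
  by move=> h; rewrite mxE divr_gt0 ?p0 // mulr_gt0 ?p0 // Wp.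
split=> [i|i j]; first by rewrite Qp // eqxx orbT.
by apply: connect_sub (hE i j) => k l Ekl; apply: connect1; rewrite Qp // Ekl.
Qed.

(** First order optimality, from a second order upper bound of the costs at [x]
    in place of differentiability. *)
Lemma gradient_sum_eq0 (f : 'I_n.+1 -> 'cV[R]_d -> R) (g : 'I_n.+1 -> 'cV[R]_d)
    (C : 'I_n.+1 -> R) (x : 'cV[R]_d) :
  (forall k v, f k (x + v) <= f k x + dot (g k) v + C k * dot v v) ->
  minimizer (aggregate f) x -> \sum_k g k = 0.
Proof.
move=> up xmin; have D := semi_inner_dot R d; have [_ Dl _ _] := D.
pose S := \sum_k g k.
have SS : dot S S = \sum_k dot (g k) S.
  rewrite {1}/S; elim/big_rec2: _ => [|k a b _ <-]; first by rewrite (semi_inner0l D).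
  by rewrite Dl.
apply: dot_eq0; apply/eqP; rewrite -/S eq_le; apply/andP; split; last by case: D.
apply: (@le_of_perturbation _ _ _ (\sum_k C k * dot S S)) => t /andP[t0 _].
rewrite add0r -(ler_pM2l t0).
have : \sum_k f k x <= \sum_k f k (x + - t *: S).
  have iN : 0 < n.+1%:R^-1 :> R by rewrite invr_gt0.
  by have := xmin (x + - t *: S); rewrite /aggregate (ler_pM2l iN).
move=> /le_trans/(_ (ler_sum _ (fun k _ => up k (- t *: S)))).
rewrite !big_split /= -addrA lerDl.
under eq_bigr do rewrite (semi_innerZr D).
rewrite -mulr_sumr -SS.
under eq_bigr do rewrite (semi_inner_sqrZ D) sqrrN mulrCA.
rewrite -mulr_sumr; lra.
Qed.

Section Push.
Variables (f : 'I_n.+1 -> 'cV[R]_d -> R) (alpha0 c : R) (l C : 'I_n.+1 -> R).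
Variables (xstar : 'cV[R]_d) (x0 : 'I_n.+1 -> 'cV[R]_d).
Hypothesis hl0 : forall j, 0 <= l j.
Hypothesis hl : forall j x y, dot (grad (f j) x - grad (f j) y) (grad (f j) x - grad (f j) y)
   <= l j ^+ 2 * dot (x - y) (x - y).
Hypothesis hup : forall j x v,
  f j (x + v) <= f j x + dot (grad (f j) x) v + C j * dot v v.
Hypothesis c0 : 0 < c.
Hypothesis hc : contracting_steps p averaging_of (fun j => grad (f j)) c alpha0.
Hypothesis hxstar : minimizer (aggregate f) xstar.

(** The argument common to the two cases: Lipschitz gradients, a quadratic upper
    bound of the costs and the contraction of the steps. *)
Lemma gradient_push_bound :
  exists K : R, 0 < K /\
    forall alpha : R, 0 < alpha <= alpha0 ->
      exists M r : R, [/\ 0 < M, 0 < r < 1 &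
        forall (w x z : nat -> 'I_n.+1 -> 'cV[R]_d) (y : nat -> 'I_n.+1 -> R),
          gradient_push W f alpha x0 w x z y ->
          forall (t : nat) (k : 'I_n.+1), (1 <= t)%N ->
            enorm (z t k - xstar) <= M * r ^+ t + K * alpha].
Proof.
have hQ := averaging_ofP.
pose nw := node_weight p.
have nw0 j : 0 < nw j by exact: node_weight_gt0 hQ j.
pose F := @scaled_grad R n d p (fun j => grad (f j)).
pose Lam := \sum_j nw j * l j.
have Lam0 : 0 <= Lam by apply: sumr_ge0 => j _; rewrite mulr_ge0 // ltW.
have F_lip u v : seminorm (@wdot R n p d) (F u - F v) <= Lam * seminorm (@wdot R n p d) (u - v).
  apply: (wnorm_le_cols hQ) => // j.
  rewrite !colB !col_scaled_grad -scalerBr (semi_inner_sqrZ (semi_inner_dot R d)).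
  apply: le_trans (ler_wpM2l (sqr_ge0 _) (hl _ _ _)) _; rewrite mulrA -exprMn.
  rewrite ler_wpM2r //; first by case: (semi_inner_dot R d).
  rewrite ler_sqr ?nnegrE // ?mulr_ge0 ?(ltW (nw0 j)) // /Lam (bigD1 j) //= lerDl.
  by apply: sumr_ge0 => i _; rewrite mulr_ge0 // ltW.
pose us : 'M[R]_(d, n.+1) := xstar *m const_mx 1.
have colus j : col j us = xstar.
  by apply/matrixP => k i; rewrite ord1 !mxE big_ord1 mxE mulr1.
have F_mean : mean p (F us) = 0.
  apply/matrixP => k i; rewrite ord1 meanE.
  under eq_bigr do rewrite mxE colus mulrA (node_weightK hQ).
  rewrite -mulr_sumr mxE.
  have /matrixP/(_ k 0) := gradient_sum_eq0 (fun k v => hup k xstar v) hxstar.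
  by rewrite summxE mxE => ->; rewrite mulr0.
have [sigma s01 geo] := avg_geometric hQ; have /andP[s0 s1] := s01.
have [Ce Ce0 hCe] := geo nw.
have [m m0 hm] := pos_lower_bound nw0.
pose U0 : 'M[R]_(d, n.+1) := \matrix_(k, j) (nw j * (\sum_i W j i *: x0 i) k 0).
have Cm0 : 0 <= Ce / m by rewrite divr_ge0 // ltW.
have [K K0 hK] := perturbed_iteration hQ Lam0 F_lip F_mean c0 hc U0 s01 Cm0.
pose S := \sum_k Num.sqrt (p k)^-1.
have S0 : 0 <= S by apply: sumr_ge0 => k _; exact: sqrtr_ge0.
exists (S * K + 1); split; first by rewrite ltr_wpDl // mulr_ge0.
move=> alpha ha; have [M [r [M0 r01 hM]]] := hK alpha ha.
have /andP[r0 r1] := r01; have /andP[a0 _] := ha.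
exists (S * M / r + 1), r; split=> //.
  by rewrite ltr_wpDl // divr_ge0 ?(ltW r0) // mulr_ge0.
move=> w x z y [init iter] [|t] // k _.
(* The iterates are shifted by one, since [w 0] and [z 0] are arbitrary. *)
pose u s : 'M[R]_(d, n.+1) := \matrix_(k, j) (nw j * w s.+1 j k 0).
pose zm s : 'M[R]_(d, n.+1) := \matrix_(k, j) (z s.+1 j k 0).
(* [eta] is averaged by the network too, and it has mean one. *)
pose eta s j := nw j * y s j.
have colu s j : col j (u s) = nw j *: w s.+1 j.
  by apply/matrixP => a b; rewrite ord1 !mxE.
have colz s j : col j (zm s) = z s.+1 j.
  by apply/matrixP => a b; rewrite ord1 !mxE.
have eta_init j : eta 0%N j = nw j by rewrite /eta (init j).2 mulr1.
have nwQ i j : nw i * W i j = averaging_of j i * nw j.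
  by rewrite mxE /nw /node_weight /p; field; rewrite !gt_eqF // p0.
have eta_iter s j : eta s.+1 j = avg averaging_of (eta s) j.
  rewrite /eta; have [_ -> _ _] := iter s j.
  by rewrite mulr_sumr; apply: eq_bigr => i _; rewrite mulrA nwQ mulrA.
have eta_ge s j : m <= eta s j.
  elim: s j => [|s IH] j; first by rewrite eta_init hm.
  by rewrite eta_iter; apply: (avg_ge hQ).
have eta_mean : \sum_j p j * nw j = 1.
  under eq_bigr do rewrite (node_weightK hQ).
  by rewrite sumr_const card_ord -(mulr_natr (n.+1%:R^-1)) mulVf // gt_eqF.
have etaP s j : `|eta s j - 1| <= Ce * sigma ^+ s.
  by have := hCe eta eta_init eta_iter s j; rewrite eta_mean.
have bound := hM u zm (fun s j => (eta s.+1 j)^-1) _ _ _ _ t.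
have {}bound : seminorm (@wdot R n p d) (zm t - us) <= M * r ^+ t + K * alpha.
  apply: bound => [|s|s j|s j].
  - apply/matrixP => a j; rewrite !mxE; have [-> _ _ _] := iter 0%N j.
    by congr (_ * _); rewrite !summxE; apply: eq_bigr => i _; rewrite (init i).1.
  - apply/matrixP => a j; rewrite !mxE; have [-> _ _ _] := iter s.+1 j.
    rewrite summxE mulr_sumr; apply: eq_bigr => i _.
    rewrite !mxE mulrA nwQ colz; have [_ _ _ ->] := iter s i.
    rewrite !mxE -/nw; ring.
  - rewrite colz colu scalerA; have [_ _ -> _] := iter s j; congr (_ *: _).
    by rewrite /eta invfM mulrC mulrA divff ?mul1r // gt_eqF.
  - have e0 : 0 < eta s.+1 j by apply: lt_le_trans (eta_ge _ _).
    have -> : (eta s.+1 j)^-1 - 1 = (1 - eta s.+1 j) / eta s.+1 j.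
      by field; rewrite gt_eqF.
    rewrite normrM normfV (gtr0_norm e0) distrC ler_pdivrMr //.
    apply: le_trans (etaP _ _) _; rewrite exprS mulrA.
    apply: le_trans (_ : Ce / m * sigma ^+ s * m <= _); last first.
      by rewrite ler_wpM2l // mulr_ge0 // exprn_ge0 // ltW.
    rewrite [leRHS]mulrAC divfK ?gt_eqF // ler_wpM2r ?exprn_ge0 ?(ltW s0) //.
    by rewrite ler_piMr // ltW.
have -> : z t.+1 k - xstar = col k (zm t - us) by rewrite colB colz colus.
apply: le_trans (enorm_col_le hQ _ _) _; rewrite -/S.
apply: le_trans (ler_wpM2l S0 bound) _.
have : S * M / r * r ^+ t.+1 = S * M * r ^+ t by rewrite exprS mulrA divfK // gt_eqF.
have : 0 <= r ^+ t.+1 by rewrite exprn_ge0 // ltW.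
move: (r ^+ t.+1) (r ^+ t) (S * M / r) a0 => a b e; lra.
Qed.

End Push.
End Network.

Unset Implicit Arguments.

Theorem theorem1p2 (R : realType) (n d : nat) (hd : (0 < d)%N)
    (E : rel 'I_n.+1) (W : 'M[R]_n.+1) (pi : 'cV[R]_n.+1)
    (hE : strongly_connected E) (hW : weights_of E W)
    (hWstoch : column_stochastic W) (hpi : stationary W pi)
    (f : 'I_n.+1 -> 'cV[R]_d -> R) (alpha0 : R)
    (hf : strongly_convex_costs pi f alpha0 \/ quadratic_costs pi f alpha0)
    (xstar : 'cV[R]_d) (hxstar : minimizer (aggregate f) xstar)
    (x0 : 'I_n.+1 -> 'cV[R]_d) :
  exists K : R, 0 < K /\
    forall alpha : R, 0 < alpha <= alpha0 ->
      exists M r : R, [/\ 0 < M, 0 < r < 1 &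
        forall (w x z : nat -> 'I_n.+1 -> 'cV[R]_d) (y : nat -> 'I_n.+1 -> R),
          gradient_push W f alpha x0 w x z y ->
          forall (t : nat) (k : 'I_n.+1), (1 <= t)%N ->
            enorm (z t k - xstar) <= M * r ^+ t + K * alpha].
Proof.
have [al0|al0] := leP alpha0 0.
  (* No stepsize is admissible. *)
  exists 1; split=> // alpha /andP[a0 a1].
  by have := lt_le_trans a0 (le_trans a1 al0); rewrite ltxx.
have hQ := averaging_ofP hE hW hWstoch hpi.
have D := semi_inner_dot R d.
have D0 (x : 'cV[R]_d) : 0 <= dot x x by case: D => _ _ _; apply.
case: hf => [[mu [L [mu0 cf sf al0E]]]|[A [B [L [mu [eps [hA [mu0 cf] hL eps0 al0E]]]]]]].
  have L0 k : 0 <= L k.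
    exact: le_trans (ltW (mu0 k)) (strong_convexity_le_smoothness (sf k) (cf k) hd).
  have [c c0 hc] := strongly_convex_contracting hQ hd mu0 cf sf.
  rewrite -al0E in hc.
  apply: (@gradient_push_bound R n d E W pi hE hW hWstoch hpi f alpha0 c L (fun k => L k / 2)
            xstar x0 L0 _ _ c0 hc hxstar) => [j x y|j x v].
    rewrite -!(seminorm_sqr D) -exprMn ler_sqr ?nnegrE ?mulr_ge0 ?seminorm_ge0 //.
    by rewrite -!enormE; exact: (sf j).2.
  exact: smooth_upper (sf j) x v.
have pA k : psd (A k) by case: (hA k).
have fE k : f k = quadratic (A k) (B k) by apply/funext; case: (hA k).
have gE k x : grad (f k) x = A k *m x + (B k)^T.
  by rewrite fE grad_quadratic //; case: (pA k).
have hLq k x : qform (A k) x x <= L k * dot x x.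
  by apply: rayleigh_le => //; case: (hL k).
have L0 k : 0 <= L k by exact: psd_bound_ge0 hd (pA k) (hLq k).
have quad_ge x : n.+1%:R * mu * dot x x <= \sum_k qform (A k) x x.
  have half01 : 0 <= (2^-1 : R) <= 1 by rewrite invr_ge0 ler0n invf_le1 ?ler1n.
  have := cf x (- x) 2^-1 half01.
  have -> : 2^-1 *: x + (1 - 2^-1) *: - x = 0.
    by apply/matrixP => i j; rewrite !mxE; field.
  have N0 : 0 < n.+1%:R :> R by exact: ltr0Sn.
  rewrite enormE (seminorm_sqr D) opprK (semi_inner_sqrD D).
  have q0 : aggregate f 0 = 0.
    rewrite /aggregate big1 ?mulr0 // => k _.
    by rewrite fE /quadratic !mulmx0 !mxE !mulr0 addr0.
  have q2 : aggregate f x + aggregate f (- x) = n.+1%:R^-1 * \sum_k qform (A k) x x.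
    rewrite /aggregate -mulrDr -big_split; congr (_ * _); apply: eq_bigr => k _ /=.
    rewrite fE /quadratic -!/(qform (A k) _ _) mulmxN.
    have Q := semi_inner_qform (pA k).
    by rewrite (semi_innerNl Q) (semi_innerNr Q) opprK [(- _ : 'M[R]_1) 0 0]mxE; field.
  rewrite q0 => h.
  have : mu * dot x x <= n.+1%:R^-1 * \sum_k qform (A k) x x by rewrite -q2; lra.
  by rewrite ler_pdivlMl // mulrA.
have [|c c0 hc] := quadratic_contracting hQ B hd pA hLq mu0 quad_ge eps0.
  by rewrite -al0E.
rewrite -al0E in hc.
apply: (@gradient_push_bound R n d E W pi hE hW hWstoch hpi f alpha0 c L (fun k => L k / 2)
          xstar x0 L0 _ _ c0 _ hxstar) => [j x y|j x v|].
- rewrite !gE opprD addrACA subrr addr0 -mulmxBr.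
  apply: le_trans (psd_mulmx_sqr _ (pA j) (hLq j)) _.
  by rewrite expr2 -mulrA ler_wpM2l.
- rewrite gE fE quadraticD; last by case: (pA j).
  by rewrite lerD2l; have := hLq j v; lra.
have -> // : (fun k => grad (f k)) = (fun k x => A k *m x + (B k)^T).
by apply/funext => k; apply/funext.
Qed.
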